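(* Let $G$ be a discrete group, and let $\mathbb{L}:G\to[0,\infty)$ be a length function of bounded doubling on $G$. Let $D=M_{\mathbb{L}}$ be the associated multiplication operator on $\ell^2(G)$. Then the seminorm $L_D$ defined on $c_c=C_c(G)$ by $L_D(f)=\|[D,\lambda_f]\|$ is a Lip-norm on $C^*(G)$.
   Context: A length function on a group $G$ with identity $e$ is a function $\mathbb{L}:G\to[0,\infty)$ with $\mathbb{L}(xy)\le \mathbb{L}(x)+\mathbb{L}(y)$, $\mathbb{L}(x^{-1})=\mathbb{L}(x)$, and $\mathbb{L}(x)=0$ if and only if $x=e$. Put $B(r)=\{x\in G:\mathbb{L}(x)\le r\}$. $\mathbb{L}$ is proper if $B(r)$ is finite for every $r<\infty$. $\mathbb{L}$ has bounded doubling if it is proper and there is a constant $C_{\mathbb{L}}<\infty$ with $|B(2r)|\le C_{\mathbb{L}}|B(r)|$ for all $r\ge 1$. $c_c=C_c(G)$ is the convolution $*$-algebra of finitely supported functions $G\to\mathbb{C}$. For $f\in c_c$, $\lambda_f$ is the bounded operator on $\ell^2(G)$ given by $(\lambda_f\xi)(x)=(f*\xi)(x)=\sum_{y\in G}f(xy^{-1})\xi(y)$. The reduced group $C^*$-algebra $C^*_r(G)$ is the operator-norm closure of $\lambda(c_c)$, and $c_c$ is identified with its image, a dense $*$-subalgebra. Under the bounded doubling hypothesis $G$ is amenable, so the full and reduced group $C^*$-algebras coincide, and this algebra is denoted $C^*(G)$. $M_h$ denotes the (possibly unbounded) operator on $\ell^2(G)$ of pointwise multiplication by $h:G\to\mathbb{C}$.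 For $f\in c_c$ the commutator $[D,\lambda_f]$ extends to a bounded operator on $\ell^2(G)$, and $\|\cdot\|$ is the operator norm. Let $L$ be a $*$-seminorm (that is, a seminorm with $L(a^* )=L(a)$) with $L(1)=0$ on a dense $*$-subalgebra $A$ of a unital $C^*$-algebra $\bar A$. Define on the state space $S(\bar A)$ the metric (possibly taking the value $+\infty$) $\rho_L(\mu,\nu)=\sup\{|\mu(a)-\nu(a)|:a\in A,\ L(a)\le 1\}$. $L$ is called a Lip-norm if the topology on $S(\bar A)$ defined by $\rho_L$ coincides with the weak-$*$ topology. *)

(* Defs.v *)
From HB Require Import structures.
From mathcomp Require Import all_boot all_order all_algebra finmap.
From mathcomp Require Import complex lra.
From mathcomp Require Import all_classical all_reals all_analysis.

Set Implicit Arguments.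
Unset Strict Implicit.
Unset Printing Implicit Defensive.

Import Order.TTheory GRing.Theory Num.Theory.
Import ComplexField.Normc.
Import numFieldNormedType.Exports.

Local Open Scope classical_set_scope.
Local Open Scope complex_scope.
Local Open Scope ring_scope.

Section SquareSummable.
Context {R : realType} {T : choiceType}.
Local Notation C := R[i].
Implicit Types (f g : T -> C).

Definition sqnorm f : \bar R := \esum_(x in [set: T]) ((normc (f x)) ^+ 2)%:E.

Definition square_summable : {pred T -> C} := fun f => (sqnorm f < +oo)%E.

Lemma normc_ge0 (z : C) : 0 <= normc z.
Proof. by case: z => a b; exact: sqrtr_ge0. Qed.

Lemma sqnorm_ge0 f : (0 <= sqnorm f)%E.
Proof. by apply: esum_ge0 => x _; rewrite lee_fin sqr_ge0. Qed.

Lemma le_sqnormZ (a : C) f :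
  (sqnorm (a *: f)%R <= (normc a ^+ 2)%:E * sqnorm f)%E.
Proof.
apply: ge_ereal_sup => _ [A [finA _] <-].
rewrite (_ : (\sum_(x \in A) _)%E =
    ((normc a ^+ 2)%:E * \sum_(x \in A) ((normc (f x)) ^+ 2)%:E)%E).
  rewrite lee_wpmul2l ?lee_fin ?sqr_ge0//.
  by apply: ereal_sup_ubound; exists A.
rewrite ge0_mule_fsumr; last by move=> x; rewrite lee_fin sqr_ge0.
by apply: eq_fsbigr => x _; rewrite -EFinM -exprMn -normcM.
Qed.

Lemma normcD2 (a b : C) :
  normc (a + b) ^+ 2 <= 2 * (normc a ^+ 2 + normc b ^+ 2).
Proof.
case: a b => [a1 a2] [b1 b2] /=.
rewrite !sqr_sqrtr ?addr_ge0 ?sqr_ge0//.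
have := sqr_ge0 (a1 - b1); have := sqr_ge0 (a2 - b2).
by nra.
Qed.

Lemma le_sqnormD f g : (sqnorm (f + g)%R <= 2%:E * (sqnorm f + sqnorm g))%E.
Proof.
rewrite /sqnorm -esumD; try by move=> x _; rewrite lee_fin sqr_ge0.
apply: ge_ereal_sup => _ [A [finA _] <-].
apply: (@le_trans _ _ (\sum_(x \in A) (2 * (normc (f x) ^+ 2 + normc (g x) ^+ 2))%:E)%E).
  by apply: lee_fsum => // x _; rewrite lee_fin normcD2.
under eq_fsbigr do rewrite EFinM.
rewrite -ge0_mule_fsumr; last by move=> x; rewrite lee_fin addr_ge0 ?sqr_ge0.
rewrite lee_wpmul2l ?lee_fin//.
by apply: ereal_sup_ubound; exists A.
Qed.

Lemma square_summable_submod : submod_closed square_summable.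
Proof.
have h0 : 0 \in square_summable.
  rewrite unfold_in /sqnorm esum1// => x _.
  by rewrite (_ : (0 : T -> C) x = 0)// normc0 expr0n.
split => // a f g; rewrite !unfold_in => sf sg.
apply: (le_lt_trans (le_sqnormD _ _)).
rewrite lte_mul_pinfty ?lee_fin// lte_add_pinfty//.
apply: (le_lt_trans (le_sqnormZ _ _)).
by rewrite lte_mul_pinfty ?lee_fin ?sqr_ge0.
Qed.

HB.instance Definition _ :=
  GRing.isSubmodClosed.Build C (T -> C) square_summable square_summable_submod.

End SquareSummable.

Section L2.
Variables (R : realType) (T : choiceType).
Local Notation C := R[i].

Record l2 := L2 { l2_fun :> T -> C; l2P : l2_fun \in square_summable }.

HB.instance Definition _ := [isSub for l2_fun].
HB.instance Definition _ := [Choice of l2 by <:].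
HB.instance Definition _ := [SubChoice_isSubLmodule of l2 by <:].

End L2.

Section L2Theory.
Context {R : realType} {T : choiceType}.
Local Notation C := R[i].
Local Notation H := (l2 R T).
Implicit Types (xi eta : H).

Lemma l2_inj xi eta : (forall x, xi x = eta x) -> xi = eta.
Proof. by move=> h; apply: val_inj; apply/funext. Qed.

Definition l2norm xi : R := Num.sqrt (fine (sqnorm xi)).

Lemma sqnorm_fin xi : sqnorm xi \is a fin_num.
Proof. by rewrite ge0_fin_numE ?sqnorm_ge0//; exact: l2P. Qed.

Lemma l2norm_ge0 xi : 0 <= l2norm xi.
Proof. exact: sqrtr_ge0. Qed.

Lemma sqr_l2norm xi : (l2norm xi ^+ 2)%:E = sqnorm xi.
Proof. by rewrite sqr_sqrtr ?fine_ge0 ?sqnorm_ge0// fineK ?sqnorm_fin. Qed.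

Lemma le_l2normD xi eta : l2norm (xi + eta) <= 2 * (l2norm xi + l2norm eta).
Proof.
have := le_sqnormD xi eta; rewrite -[sqnorm (_ + _)]/(sqnorm (xi + eta)%R).
rewrite -!sqr_l2norm -EFinD -EFinM lee_fin => h.
rewrite -ler_sqr ?nnegrE ?mulr_ge0 ?addr_ge0 ?l2norm_ge0//.
apply: (le_trans h).
have := l2norm_ge0 xi; have := l2norm_ge0 eta.
by nra.
Qed.

Lemma le_l2normZ a xi : l2norm (a *: xi) <= normc a * l2norm xi.
Proof.
have := le_sqnormZ a xi; rewrite -[sqnorm (_ *: _)]/(sqnorm (a *: xi)%R).
rewrite -!sqr_l2norm -EFinM lee_fin -exprMn.
by rewrite ler_sqr ?nnegrE ?mulr_ge0 ?normc_ge0 ?l2norm_ge0.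
Qed.

Lemma normc_le_l2norm xi x : normc (xi x) <= l2norm xi.
Proof.
rewrite -ler_sqr ?nnegrE ?normc_ge0 ?l2norm_ge0// -lee_fin sqr_l2norm.
apply: esum_ge; exists [set x]; first by split.
by rewrite fsbig_set1.
Qed.

Lemma l2norm0 : l2norm 0 = 0 :> R.
Proof.
apply/eqP; rewrite eq_le l2norm_ge0 andbT.
by have := le_l2normZ 0 0; rewrite scaler0 normc0 mul0r.
Qed.

Lemma l2norm0_eq0 xi : l2norm xi = 0 -> xi = 0.
Proof.
move=> h; apply: l2_inj => x; apply: eq0_normc; apply/eqP.
by rewrite eq_le normc_ge0 andbT -h normc_le_l2norm.
Qed.

Lemma l2normZ a xi : l2norm (a *: xi) = normc a * l2norm xi.
Proof.
apply/eqP; rewrite eq_le le_l2normZ/=.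
have [->|a0] := eqVneq a 0; first by rewrite normc0 mul0r l2norm_ge0.
have na0 : normc a != 0 by apply: contra a0 => /eqP /eq0_normc ->.
have := le_l2normZ a^-1 (a *: xi); rewrite scalerA mulVf// scale1r normcV.
by rewrite mulrC ler_pdivlMr ?lt_neqAle ?normc_ge0 ?andbT 1?eq_sym// mulrC.
Qed.

Lemma delta_subproof (a : T) : (fun x => (x == a)%:R : C) \in square_summable.
Proof.
rewrite unfold_in /sqnorm.
rewrite (_ : esum _ _ = \esum_(x in [set a]) (1 : R)%:E).
  by rewrite esum_set1 ?lee_fin ?ltry.
rewrite [RHS]esum_mkcond; apply: eq_esum => x _.
have [->|xa] := eqVneq x a; first by rewrite mem_set// normc1 expr1n.
by rewrite memNset ?normc0 ?expr0n//; apply/eqP.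
Qed.
Definition delta (a : T) : H := L2 (delta_subproof a).

End L2Theory.

Section BoundedOperators.
Variables (R : realType) (G : groupType).
Local Notation C := R[i].
Local Notation H := (l2 R G).

(* Bounded operators on l2(G), with composition as product. *)
Definition bounded_linear : {pred H -> H} := fun u =>
  `[< linear u /\ exists M : R, forall xi, l2norm (u xi) <= M * l2norm xi >].

Lemma bounded_linear_submod : submod_closed bounded_linear.
Proof.
have ge0M (u : H -> H) : u \in bounded_linear ->
    linear u /\ exists2 M : R, 0 <= M & forall xi, l2norm (u xi) <= M * l2norm xi.
  move=> /asboolP[lu [M hM]]; split=> //; exists `|M| => // xi.
  by apply: (le_trans (hM xi)); rewrite ler_wpM2r ?l2norm_ge0 ?ler_norm.
split.
  apply/asboolP; split; first by move=> a x y; rewrite /= scaler0 addr0.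
  by exists 0 => xi; rewrite l2norm0 mul0r.
move=> a u v /ge0M[lu [M M0 hM]] /ge0M[lv [N N0 hN]].
apply/asboolP; split.
  move=> b x y; pose w z : H := a *: u z + v z.
  suff : w (b *: x + y) = b *: w x + w y by [].
  by rewrite /w lu lv !scalerDr !scalerA (mulrC a b) addrACA.
exists (2 * (normc a * M + N)) => xi; rewrite [X in l2norm X]/(a *: u xi + v xi).
apply: (le_trans (le_l2normD _ _)); rewrite -mulrA ler_wpM2l// mulrDl lerD//.
by rewrite l2normZ -mulrA ler_wpM2l ?normc_ge0.
Qed.

HB.instance Definition _ :=
  GRing.isSubmodClosed.Build C (H -> H) bounded_linear bounded_linear_submod.

Record bop := Bop { bop_fun :> H -> H; bopP : bop_fun \in bounded_linear }.

HB.instance Definition _ := [isSub for bop_fun].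
HB.instance Definition _ := [Choice of bop by <:].
HB.instance Definition _ := [SubChoice_isSubLmodule of bop by <:].

Implicit Types u v w : bop.

Lemma bop_inj u v : (forall xi, u xi = v xi) -> u = v.
Proof. by move=> h; apply: val_inj; apply/funext. Qed.

Lemma bop_linear u : linear u.
Proof. by have /asboolP[] := bopP u. Qed.

HB.instance Definition _ u := GRing.isLinear.Build C H H _ u (bop_linear u).

Lemma bop_bounded u :
  exists2 M : R, 0 <= M & forall xi, l2norm (u xi) <= M * l2norm xi.
Proof.
have /asboolP[_ [M hM]] := bopP u; exists `|M| => // xi.
by apply: (le_trans (hM xi)); rewrite ler_wpM2r ?l2norm_ge0 ?ler_norm.
Qed.

Lemma bop1_subproof : id \in bounded_linear.
Proof. by apply/asboolP; split=> //; exists 1 => xi; rewrite mul1r. Qed.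
Definition bop1 := Bop bop1_subproof.

Lemma bop_comp_subproof u v : (u \o v) \in bounded_linear.
Proof.
apply/asboolP; split; first by move=> a x y; rewrite /= !linearP.
have [M M0 hM] := bop_bounded u; have [N N0 hN] := bop_bounded v.
exists (M * N) => xi /=; apply: (le_trans (hM _)).
by rewrite -mulrA ler_wpM2l.
Qed.
Definition bop_comp u v := Bop (bop_comp_subproof u v).

Lemma bop_compA : associative bop_comp.
Proof. by move=> u v w; apply: bop_inj. Qed.
Lemma bop_comp1l : left_id bop1 bop_comp.
Proof. by move=> u; apply: bop_inj. Qed.
Lemma bop_comp1r : right_id bop1 bop_comp.
Proof. by move=> u; apply: bop_inj. Qed.
Lemma bop_compDl : left_distributive bop_comp +%R.
Proof. by move=> u v w; apply: bop_inj. Qed.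
Lemma bop_compDr : right_distributive bop_comp +%R.
Proof. by move=> u v w; apply: bop_inj => xi; exact: linearD. Qed.

HB.instance Definition _ := GRing.Zmodule_isPzRing.Build bop
  bop_compA bop_comp1l bop_comp1r bop_compDl bop_compDr.

Lemma bop_scaleAl (a : C) u v : a *: (u * v) = a *: u * v.
Proof. by apply: bop_inj. Qed.
Lemma bop1_neq0 : 1 != 0 :> bop.
Proof.
apply/eqP => /(congr1 (fun u : bop => u (delta 1%g) 1%g)).
rewrite [LHS](_ : _ = 1); last by rewrite /= eqxx.
by apply/eqP; rewrite oner_eq0.
Qed.
HB.instance Definition _ := GRing.PzSemiRing_isNonZero.Build bop bop1_neq0.
HB.instance Definition _ := GRing.Lmodule_isLalgebra.Build C bop bop_scaleAl.

Lemma bop_scaleAr (a : C) u v : a *: (u * v) = u * (a *: v).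
Proof. by apply: bop_inj => xi; rewrite [RHS]linearZ. Qed.
HB.instance Definition _ := GRing.Lalgebra_isAlgebra.Build C bop bop_scaleAr.

Definition opnorm u : \bar R :=
  ereal_sup [set (l2norm (u xi))%:E | xi in [set xi : H | l2norm xi <= 1]].
End BoundedOperators.
Arguments opnorm {R G} u%_ring_scope.

Section GroupCstar.
Variables (R : realType) (G : groupType).
Local Notation C := R[i].
Local Notation H := (l2 R G).

Definition fin_supp_fun := {fsfun G -> C with 0}.
Local Notation c_c := fin_supp_fun.
Implicit Types (f g : c_c) (u v : bop R G).

(* For each x only finitely many terms are nonzero, so the sum is the full sum
   over G. *)
Definition conv (f : c_c) (xi : G -> C) : G -> C :=
  fun x => \sum_(y \in [set: G]) f (x * y^-1)%g * xi y.

Lemma sqnorm_transl (a : G) (xi : G -> C) :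
  sqnorm (fun x => xi (a^-1 * x)%g) = sqnorm xi.
Proof.
rewrite [RHS](@reindex_esum _ _ _ [set: G] _ (fun x => a^-1 * x)%g)//.
rewrite setTT_bijective; exists (fun x => a * x)%g => x.
  by rewrite mulgA mulgV mul1g.
by rewrite mulgA mulVg mul1g.
Qed.

Lemma transl_subproof (a : G) (xi : H) :
  (fun x => xi (a^-1 * x)%g) \in square_summable.
Proof. by rewrite unfold_in sqnorm_transl; exact: l2P. Qed.

Lemma transl_bounded (a : G) :
  (fun xi : H => L2 (transl_subproof a xi)) \in @bounded_linear R G.
Proof.
apply/asboolP; split; first by move=> b x y; apply: l2_inj.
by exists 1 => xi; rewrite mul1r /l2norm sqnorm_transl.
Qed.
Definition transl a : bop R G := Bop (transl_bounded a).

Lemma bop_sumE (s : seq G) (c : G -> C) (u : G -> bop R G) (xi : H) x :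
  (\sum_(a <- s) c a *: u a) xi x = \sum_(a <- s) c a * u a xi x.
Proof.
elim: s => [|a s IH]; first by rewrite !big_nil.
by rewrite !big_cons -IH.
Qed.

Lemma convE f (A : {fset G}) (xi : H) : (forall a, a \notin A -> f a = 0) ->
  conv f xi = (\sum_(a <- A) f a *: transl a) xi.
Proof.
move=> fA; apply/funext => x; rewrite bop_sumE /conv.
rewrite (reindex_fsbigT (fun a => a^-1 * x)%g); last first.
  exists (fun y => x * y^-1)%g => y; first by rewrite invgM invgK mulgA mulgV mul1g.
  by rewrite invgM invgK -mulgA mulVg mulg1.
rewrite (fsbigTE A).
  by apply: eq_bigr => a _; rewrite invgM invgK mulgA mulgV mul1g.
by move=> a /fA; rewrite invgM invgK mulgA mulgV mul1g => ->; rewrite mul0r.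
Qed.

Lemma conv_l2 f (xi : H) : conv f xi \in square_summable.
Proof. by rewrite (convE _ (@fsfun_dflt _ _ _ f)); exact: l2P. Qed.

Lemma lambda_bounded f : (fun xi : H => L2 (conv_l2 f xi)) \in @bounded_linear R G.
Proof.
rewrite (_ : (fun _ => _) = bop_fun (\sum_(a <- finsupp f) f a *: transl a)).
  exact: bopP.
by apply/funext => xi; apply: val_inj; exact: (convE _ (@fsfun_dflt _ _ _ f)).
Qed.
Definition lambda f : bop R G := Bop (lambda_bounded f).

Lemma lambdaE f (A : {fset G}) : (forall a, a \notin A -> f a = 0) ->
  lambda f = \sum_(a <- A) f a *: transl a.
Proof. by move=> fA; apply: bop_inj => xi; apply: val_inj; exact: convE. Qed.

Definition lambda_range : set (bop R G) := range lambda.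

Lemma lambda_rangeP (A : {fset G}) (c : G -> C) :
  lambda_range (\sum_(a <- A) c a *: transl a).
Proof.
exists [fsfun x in A => c x] => //; rewrite (@lambdaE _ A); last first.
  by move=> a aA; rewrite fsfunE (negbTE aA).
by apply: eq_big_seq => a aA; rewrite fsfunE aA.
Qed.

Lemma lambda_rangeT a : lambda_range (transl a).
Proof.
have := lambda_rangeP [fset a]%fset (fun=> 1).
by rewrite big_seq_fset1 scale1r.
Qed.

Lemma lambda_rangeD u v : lambda_range u -> lambda_range v -> lambda_range (u + v).
Proof.
move=> [f _ <-] [g _ <-]; pose A := (finsupp f `|` finsupp g)%fset.
have fA a : a \notin A -> f a = 0.
  by rewrite in_fsetU negb_or => /andP[+ _]; exact: fsfun_dflt.
have gA a : a \notin A -> g a = 0.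
  by rewrite in_fsetU negb_or => /andP[_]; exact: fsfun_dflt.
rewrite (lambdaE fA) (lambdaE gA) -big_split/=.
under eq_bigr do rewrite -scalerDl.
exact: lambda_rangeP.
Qed.

Lemma lambda_rangeZ (c : C) u : lambda_range u -> lambda_range (c *: u).
Proof.
move=> [f _ <-]; rewrite (lambdaE (@fsfun_dflt _ _ _ f)) scaler_sumr.
under eq_bigr do rewrite scalerA.
exact: lambda_rangeP.
Qed.

Lemma lambda_range_sum I (s : seq I) (u : I -> bop R G) :
  (forall i, lambda_range (u i)) -> lambda_range (\sum_(i <- s) u i).
Proof.
move=> h; elim: s => [|i s IH]; last by rewrite big_cons; exact: lambda_rangeD.
by rewrite big_nil -(scale0r (transl 1%g)); exact/lambda_rangeZ/lambda_rangeT.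
Qed.

Lemma translM a b : transl a * transl b = transl (a * b)%g.
Proof. by apply: bop_inj => xi; apply: l2_inj => x /=; rewrite mulgA -invgM. Qed.

Lemma lambda_range1 : lambda_range 1.
Proof.
rewrite (_ : 1 = transl 1%g); first exact: lambda_rangeT.
by apply: bop_inj => xi; apply: l2_inj => x /=; rewrite invg1 mul1g.
Qed.

Lemma lambda_rangeM u v : lambda_range u -> lambda_range v -> lambda_range (u * v).
Proof.
move=> [f _ <-] [g _ <-]; rewrite (lambdaE (@fsfun_dflt _ _ _ f)).
rewrite (lambdaE (@fsfun_dflt _ _ _ g)) mulr_suml.
apply: lambda_range_sum => a; rewrite mulr_sumr; apply: lambda_range_sum => b.
rewrite -scalerAl -scalerAr translM.
by do 2 apply: lambda_rangeZ; exact: lambda_rangeT.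
Qed.

(* The operator-norm closure of the image of the left regular representation. *)
Definition cstar_red : {pred bop R G} := fun u =>
  `[< forall e : R, 0 < e -> exists f, (opnorm (u - lambda f) <= e%:E)%E >].

Lemma opnorm_leP (u : bop R G) (M : R) : 0 <= M ->
  (opnorm u <= M%:E)%E <-> (forall xi, l2norm (u xi) <= M * l2norm xi).
Proof.
move=> M0; split => h.
  move=> xi; have [xi0|xi0] := eqVneq (l2norm xi) 0.
    by rewrite xi0 mulr0 (l2norm0_eq0 xi0) linear0 l2norm0.
  have p : 0 < l2norm xi by rewrite lt_neqAle eq_sym xi0 l2norm_ge0.
  have nc : normc ((l2norm xi)^-1%:C) = (l2norm xi)^-1.
    by rewrite /= expr0n addr0 sqrtr_sqr ger0_norm// invr_ge0 ltW.
  rewrite -ler_pdivrMr// mulrC -nc -l2normZ -linearZ -lee_fin.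
  apply: le_trans h; apply: ereal_sup_ubound.
  by eexists; last reflexivity; rewrite /= l2normZ nc mulVf.
apply: ge_ereal_sup => _ [xi /= xi1 <-]; rewrite lee_fin.
by apply: (le_trans (h xi)); rewrite ler_piMr.
Qed.

Lemma cstar_redP (u : bop R G) : reflect
  (forall e : R, 0 < e -> exists2 v, lambda_range v &
     forall xi, l2norm ((u - v) xi) <= e * l2norm xi)
  (u \in cstar_red).
Proof.
apply: (iffP (asboolP _)) => h e e0.
  by have [f hf] := h e e0; exists (lambda f); [exists f|apply/opnorm_leP => //; exact: ltW].
by have [_ [f _ <-] hf] := h e e0; exists f; apply/opnorm_leP => //; exact: ltW.
Qed.

Lemma half_boundD (a b e z : R) :
  a <= e / 4 * z -> b <= e / 4 * z -> 2 * (a + b) <= e * z.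
Proof. lra. Qed.

Lemma cstar_red_subalg : subalg_closed cstar_red.
Proof.
split.
- apply/cstar_redP => e e0; exists 1; first exact: lambda_range1.
  by move=> xi; rewrite subrr l2norm0 mulr_ge0 ?l2norm_ge0 ?ltW.
- move=> c u v /cstar_redP hu /cstar_redP hv; apply/cstar_redP => e e0.
  have c1 : 0 < normc c + 1 by rewrite ltr_wpDl ?normc_ge0.
  have [|u' ru' hu'] := hu (e / 4 / (normc c + 1)); first by rewrite !divr_gt0.
  have [|v' rv' hv'] := hv (e / 4); first by rewrite divr_gt0.
  exists (c *: u' + v'); first by apply: lambda_rangeD => //; exact: lambda_rangeZ.
  move=> xi; rewrite opprD addrACA -scalerBr.
  apply: (le_trans (le_l2normD _ _)); rewrite l2normZ.
  have hy : normc c * l2norm ((u - u') xi) <= e / 4 * l2norm xi.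
    apply: (@le_trans _ _ (normc c * (e / 4 / (normc c + 1) * l2norm xi))).
      by rewrite ler_wpM2l ?normc_ge0.
    rewrite mulrA ler_wpM2r ?l2norm_ge0// mulrC -(mulrA (e / 4)) ler_piMr//.
      by rewrite divr_ge0 ?ltW.
    by rewrite ler_pdivrMl// mulr1 lerDl.
  by apply: half_boundD => //; exact: hv'.
- move=> u v /cstar_redP hu /cstar_redP hv; apply/cstar_redP => e e0.
  have [M M0 hM] := bop_bounded v.
  have [|u' ru' hu'] := hu (e / 4 / (M + 1)).
    by rewrite !divr_gt0// ltr_wpDl.
  have [N N0 hN] := bop_bounded u'.
  have [|v' rv' hv'] := hv (e / 4 / (N + 1)).
    by rewrite !divr_gt0// ltr_wpDl.
  exists (u' * v'); first exact: lambda_rangeM.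
  move=> xi.
  rewrite (_ : u * v - u' * v' = (u - u') * v + u' * (v - v')); last first.
    by rewrite mulrBl mulrBr addrA subrK.
  apply: (le_trans (le_l2normD _ _)).
  have h1 : l2norm (((u - u') * v) xi) <= e / 4 * l2norm xi.
    apply: (le_trans (hu' (v xi))).
    rewrite -(mulrA (e / 4)) ler_wpM2l ?divr_ge0 ?(ltW e0)//.
    rewrite ler_pdivrMl ?ltr_wpDl//; apply: (le_trans (hM xi)).
    by rewrite ler_wpM2r ?l2norm_ge0 ?lerDl.
  have h2 : l2norm ((u' * (v - v')) xi) <= e / 4 * l2norm xi.
    apply: (le_trans (hN ((v - v') xi))).
    apply: (@le_trans _ _ (N * (e / 4 / (N + 1) * l2norm xi))).
      by rewrite ler_wpM2l.
    rewrite mulrA ler_wpM2r ?l2norm_ge0// mulrC -(mulrA (e / 4)) ler_piMr//.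
      by rewrite divr_ge0 ?ltW.
    by rewrite ler_pdivrMl ?ltr_wpDl// mulr1 lerDl.
  exact: half_boundD.
Qed.

HB.instance Definition _ :=
  GRing.isSubalgClosed.Build C (bop R G) cstar_red cstar_red_subalg.

(* The reduced group C*-algebra. *)
Record Cstar := CstarElt { Cstar_op :> bop R G; CstarP : Cstar_op \in cstar_red }.

HB.instance Definition _ := [isSub for Cstar_op].
HB.instance Definition _ := [Choice of Cstar by <:].
HB.instance Definition _ := [SubChoice_isSubAlgebra of Cstar by <:].

Lemma lambda_cstar_red f : lambda f \in cstar_red.
Proof.
apply/cstar_redP => e e0; exists (lambda f); first by exists f.
by move=> xi; rewrite subrr l2norm0 mulr_ge0 ?l2norm_ge0 ?ltW.
Qed.
Definition lambda_cstar f : Cstar := CstarElt (lambda_cstar_red f).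

End GroupCstar.

Section Adjoint.
Context {R : realType}.
Local Notation C := R[i].

(* Unordered sums, meaningful for absolutely summable families. *)
Definition rsum {T : choiceType} (g : T -> R) : R :=
  fine (\esum_(x in [set: T]) ((EFin \o g)^\+)%E x) -
  fine (\esum_(x in [set: T]) ((EFin \o g)^\-)%E x).

Definition csum {T : choiceType} (g : T -> C) : C :=
  (rsum (fun x => complex.Re (g x)) +i* rsum (fun x => complex.Im (g x)))%C.

Definition inner {T : choiceType} (xi eta : l2 R T) : C :=
  csum (fun x => xi x * (eta x)^*%C).

Definition is_adjoint {G : groupType} (u v : bop R G) : Prop :=
  forall xi eta, inner (u xi) eta = inner xi (v eta).

(* The adjoint is unique, and the adjoint of an element of the reduced group
   C*-algebra lies again in it, so the default value 0 is never used. *)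
Definition star {G : groupType} (a : Cstar R G) : Cstar R G :=
  xget 0 [set b : Cstar R G | is_adjoint a b].

End Adjoint.

(* [B] is the unital C*-algebra with involution [st] and norm [nrm], [A] its
   dense *-subalgebra. Only the values on [A] of the seminorm [L] are used. *)
Section LipNorm.
Variables (R : realType) (B : algType R[i]) (st : B -> B) (nrm : B -> \bar R).

Record state := State {
  state_fun :> B -> R[i];
  state_linear : scalar state_fun;
  state_positive : forall a, 0 <= state_fun (st a * a);
  state_unital : state_fun 1 = 1 }.

HB.instance Definition _ := gen_eqMixin state.
HB.instance Definition _ := gen_choiceMixin state.

Definition weak_star : topologicalType :=
  initial_topology (fun mu : state => (mu : {ptws B -> R[i]^o})).

Variables (A : set B) (L : B -> \bar R).

Definition rho (mu nu : state) : \bar R :=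
  ereal_sup [set (normc (mu a - nu a))%:E | a in [set a | A a /\ (L a <= 1)%E]].

Definition rho_open (U : set state) : Prop :=
  forall mu, U mu ->
    exists2 e : R, 0 < e & forall nu, (rho mu nu < e%:E)%E -> U nu.

Definition star_subalgebra : Prop :=
  [/\ A 1,
      forall (c : R[i]) a b, A a -> A b -> A (c *: a + b),
      forall a b, A a -> A b -> A (a * b) &
      forall a, A a -> A (st a)].

Definition norm_dense : Prop :=
  forall (b : B) (e : R), 0 < e -> exists2 a, A a & (nrm (b - a)%R <= e%:E)%E.

Definition star_seminorm : Prop :=
  [/\ forall a, A a -> (0 <= L a < +oo)%E,
      forall a b, A a -> A b -> (L (a + b)%R <= L a + L b)%E,
      forall (c : R[i]) a, A a -> (L (c *: a)%R = (normc c)%:E * L a)%E &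
      forall a, A a -> L (st a) = L a].

Definition lip_norm : Prop :=
  [/\ star_subalgebra, norm_dense, star_seminorm, L 1 = 0%E &
      forall U : set state, rho_open U <-> @open weak_star U].

End LipNorm.

Section Length.
Variables (R : realType) (G : groupType) (l : G -> R).

Definition length_function : Prop :=
  [/\ forall x, 0 <= l x,
      forall x y, l (x * y)%g <= l x + l y,
      forall x, l x^-1%g = l x &
      forall x, l x = 0 <-> x = 1%g].

Definition length_ball (r : R) : set G := [set x | l x <= r].

Definition proper_length : Prop := forall r, finite_set (length_ball r).

Definition bounded_doubling : Prop :=
  proper_length /\
  exists c : R, forall r, 1 <= r ->
    #|` fset_set (length_ball (2 * r))|%:R <=
      c * #|` fset_set (length_ball r)|%:R.

End Length.

Section Commutator.
Variables (R : realType) (G : groupType).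
Local Notation C := R[i].
Local Notation H := (l2 R G).

(* Possibly unbounded operators on l2 are given by their graphs; the domain of
   [mulop h] consists of the xi such that h * xi is square summable. *)
Definition mulop (h : G -> C) (xi eta : H) : Prop :=
  forall x, eta x = h x * xi x.

Definition commutator (D : H -> H -> Prop) (u : bop R G) (xi zeta : H) : Prop :=
  exists eta1 eta2, [/\ D xi eta1, D (u xi) eta2 & zeta = eta2 - u eta1].

Definition bounded_extension (F : H -> H -> Prop) : set (bop R G) :=
  [set s | forall xi zeta, F xi zeta -> s xi = zeta].

(* A densely defined operator has at most one bounded extension: the infimum is
   the norm of that extension, and +oo if there is none. *)
Definition dirac_seminorm (l : G -> R) (a : Cstar R G) : \bar R :=
  ereal_inf [set opnorm s | s in
    bounded_extension (commutator (mulop (fun x => (l x)%:C%C)) a)].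

End Commutator.

(* Main.v *)
Require Import Defs.
From mathcomp Require Import all_boot all_order all_algebra finmap.
From mathcomp Require Import complex lra ring.
From mathcomp Require Import all_classical all_reals all_analysis.

Set Implicit Arguments.
Unset Strict Implicit.
Unset Printing Implicit Defensive.

Import Order.TTheory GRing.Theory Num.Theory.
Import ComplexField.Normc ComplexField.
Import numFieldNormedType.Exports.

Local Open Scope ring_scope.

(** Write l for the length function and B(r) for its balls. For f in c_c with
    L_D(f) <= 1 the commutator [D, lambda_f] has the kernel
    (l x - l y) f(x y^-1), and the theorem reduces to the estimate

      || lambda_f - lambda_(phi_r f) || <= const / r,

    where phi_r is a cutoff equal to 1 on B(r) and to 0 off B(3r), and where the
    constant depends on the doubling constant only ([kbound_tail]). It says
    that modulo a small error such an f lives on the finite set B(3r), where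
    its coefficients satisfy |f z| <= 1 / l z, the coefficient at the identity
    being invisible to a difference of two states. Hence two states that are
    close at the finitely many group elements of B(3r) are close for rho, and
    rho-open sets are weak-* open ([rho_open_weak_star_open]). The converse
    holds because rho controls the difference of two states on the dense
    subalgebra c_c, and because states are uniformly bounded
    ([weak_star_open_rho_open]).

    The estimate rests on three facts about kernels K(x, y) on G x G.
    - Averaging ([kbound_avg]): multiplying a kernel by
      (1 / |B|) * #{b in B : x y^-1 b in A} costs at most a factor
      max(|A|, |B|) / |B|. With B = B(r) and A = B(2r) this is the cutoff phi_r,
      and doubling bounds the factor. So phi_r acts boundedly on lambda_f and
      on the commutator at the same time ([kbound_cutoff]).
    - Separation ([kbound_separated]): where l x >= 2s and l y <= s, one can
      divide by l x - l y at the price of a factor 1 / s.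
    - Localization ([kbound_localized]): if f lives where 3s <= l <= 18s and y
      is restricted to the ball B(s), then l x >= 2s on the support of
      f(x y^-1), so separation applies. As f(x y^-1) is invariant under right
      translation the same bound holds with y in any translate of B(s), and
      averaging over the translates gives ||lambda_f|| <= const / s.
    Cutting f - phi_r f into the dyadic pieces (phi_(2^(k+1) r) - phi_(2^k r)) f
    and summing a geometric series gives the estimate.

    Operator norms are handled through finite sections: [kbound K M] bounds all
    finite bilinear sums of K, and [opnorm_kbound] identifies it with
    opnorm <= M for the kernel of a bounded operator. Conversely a bounded
    kernel is the kernel of an operator ([kernel_bop]), which yields adjoints,
    limits of Cauchy sequences and commutators. Boundedness of states on the whole
    algebra ([state_bounded]) needs square roots of 1 - h for small
    self-adjoint h; these come from a fixed-point iteration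
    ([sqrt_one_minus]). *)

(** * The modulus of complex numbers *)

Section Normc.
Context {R : realType}.
Implicit Types z w : R[i].

Lemma normc_real (a : R) : normc a%:C%C = `|a|.
Proof. by rewrite /= expr0n addr0 sqrtr_sqr. Qed.

Lemma normc_conj z : normc z^*%C = normc z.
Proof. by case: z => a b /=; rewrite sqrrN. Qed.

Lemma normc_sqr z : z * z^*%C = (normc z ^+ 2)%:C%C.
Proof.
case: z => a b; apply/eqP; rewrite eq_complex /=.
by rewrite sqr_sqrtr ?addr_ge0 ?sqr_ge0// !mulrN opprK mulrC [b * a]mulrC addNr !expr2 !eqxx.
Qed.

Lemma normcB z w : normc (z - w) <= normc z + normc w.
Proof. by rewrite -(normcN w) le_normcD. Qed.

Lemma le_normc_sum I (s : seq I) (P : pred I) (F : I -> R[i]) :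
  normc (\sum_(i <- s | P i) F i) <= \sum_(i <- s | P i) normc (F i).
Proof.
elim/big_rec2: _ => [|i x y _ h]; first by rewrite normc0.
by apply: le_trans (le_normcD _ _) _; rewrite lerD2l.
Qed.

Lemma normc_Re z : `|complex.Re z| <= normc z.
Proof.
case: z => a b /=; rewrite -(sqrtr_sqr a).
by rewrite ler_wsqrtr ?lerDl ?sqr_ge0.
Qed.

Lemma normc_Im z : `|complex.Im z| <= normc z.
Proof.
case: z => a b /=; rewrite -(sqrtr_sqr b).
by rewrite ler_wsqrtr ?lerDr ?sqr_ge0.
Qed.

Lemma normc_ReIm z : normc z <= `|complex.Re z| + `|complex.Im z|.
Proof.
rewrite -ler_sqr ?nnegrE ?normc_ge0 ?addr_ge0//; case: z => a b /=.
rewrite sqr_sqrtr ?addr_ge0 ?sqr_ge0// sqrrD !real_normK ?num_real//.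
by have := mulr_ge0 (normr_ge0 a) (normr_ge0 b); lra.
Qed.

Lemma normc_mul_AMGM z w (M : R) : 0 < M ->
  2 * normc (z * w) <= M^-1 * normc z ^+ 2 + M * normc w ^+ 2.
Proof.
move=> M0; rewrite normcM -subr_ge0.
rewrite [X in 0 <= X](_ : _ = M^-1 * (normc z - M * normc w) ^+ 2); last first.
  by field; rewrite gt_eqF.
by rewrite mulr_ge0 ?sqr_ge0// invr_ge0 ltW.
Qed.

End Normc.

Lemma exists_geometric_le {R : realType} (c e : R) : 0 <= c -> 0 < e ->
  exists n, c / 2 ^+ n <= e.
Proof.
move=> c0 e0; have := archi_boundP (divr_ge0 c0 (ltW e0)).
move: (Num.bound _) => n hn; exists n.
rewrite ler_pdivrMr ?exprn_gt0// [leRHS]mulrC -ler_pdivrMr//.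
apply: le_trans (ltW hn) _.
by have := ltn_expl n (isT : (1 < 2)%N); rewrite -(ltr_nat R) natrX => /ltW.
Qed.

(** * Bounded kernels *)

Section Kernels.
Context {R : realType} {T : choiceType}.
Local Notation C := R[i].
Implicit Types (S : {fset T}) (K : T -> T -> C) (xi eta : T -> C) (M : R).

Definition sqsum S xi : R := \sum_(x <- S) normc (xi x) ^+ 2.

Definition bform K S xi eta : C :=
  \sum_(x <- S) \sum_(y <- S) K x y * xi y * eta x.

(** The bound |sum K x y xi_y eta_x| <= M |xi| |eta| for all finite sections, in
    arithmetic-geometric form. Rescaling xi and eta shows that this form is
    equivalent; its right-hand side is additive in |xi|^2 and |eta|^2, so
    that bounds can be summed over a decomposition of xi and eta. *)
Definition kbound K M := forall S xi eta,
  2 * normc (bform K S xi eta) <= M * (sqsum S xi + sqsum S eta).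

Lemma sqsum_ge0 S xi : 0 <= sqsum S xi.
Proof. by apply: sumr_ge0 => x _; exact: sqr_ge0. Qed.

Lemma le_sqsum S xi eta : (forall x, normc (xi x) <= normc (eta x)) -> sqsum S xi <= sqsum S eta.
Proof. by move=> h; apply: ler_sum => x _; rewrite ler_sqr ?nnegrE ?normc_ge0. Qed.

Lemma sqsumZ S (c : C) xi : sqsum S (fun x => c * xi x) = normc c ^+ 2 * sqsum S xi.
Proof. by rewrite mulr_sumr; apply: eq_bigr => x _; rewrite normcM exprMn. Qed.

Lemma sqsum_eq S xi eta : (forall x, normc (xi x) = normc (eta x)) -> sqsum S xi = sqsum S eta.
Proof. by move=> h; apply: eq_bigr => x _; rewrite h. Qed.

Lemma kbound_ext K K' M : (forall x y, K x y = K' x y) -> kbound K M -> kbound K' M.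
Proof.
move=> h b S xi eta; rewrite [bform K' _ _ _](_ : _ = bform K S xi eta)//.
by apply: eq_bigr => x _; apply: eq_bigr => y _; rewrite h.
Qed.

Lemma kbound_le K M M' : M <= M' -> kbound K M -> kbound K M'.
Proof.
move=> h b S xi eta; apply: le_trans (b _ _ _) _.
by rewrite ler_wpM2r ?addr_ge0 ?sqsum_ge0.
Qed.

Lemma kbound0 : kbound (fun _ _ => 0) 0.
Proof.
move=> S xi eta; rewrite mul0r /bform big1 ?normc0 ?mulr0// => x _.
by rewrite big1// => y _; rewrite !mul0r.
Qed.

Lemma kboundD K K' M M' : kbound K M -> kbound K' M' ->
  kbound (fun x y => K x y + K' x y) (M + M').
Proof.
move=> b b' S xi eta.
have -> : bform (fun x y => K x y + K' x y) S xi eta =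
    bform K S xi eta + bform K' S xi eta.
  rewrite -big_split; apply: eq_bigr => x _; rewrite -big_split.
  by apply: eq_bigr => y _; rewrite !mulrDl.
have := b S xi eta; have := b' S xi eta.
by have := le_normcD (bform K S xi eta) (bform K' S xi eta); lra.
Qed.

Lemma formZ (c : C) K S xi eta :
  bform (fun x y => c * K x y) S xi eta = c * bform K S xi eta.
Proof.
rewrite mulr_sumr; apply: eq_bigr => x _; rewrite mulr_sumr.
by apply: eq_bigr => y _; rewrite !mulrA.
Qed.

Lemma kboundZ (c : C) K M : kbound K M ->
  kbound (fun x y => c * K x y) (normc c * M).
Proof.
move=> b S xi eta; rewrite formZ normcM mulrCA -mulrA.
by rewrite ler_wpM2l ?normc_ge0.
Qed.

Lemma kboundN K M : kbound K M -> kbound (fun x y => - K x y) M.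
Proof.
move=> /(kboundZ (-1)); rewrite normcN normc1 mul1r.
by apply: kbound_ext => x y; rewrite mulN1r.
Qed.

Lemma kboundB K K' M M' : kbound K M -> kbound K' M' ->
  kbound (fun x y => K x y - K' x y) (M + M').
Proof. by move=> b /kboundN; exact: kboundD. Qed.

Lemma kbound_sum I (s : seq I) (K : I -> T -> T -> C) (M : I -> R) :
  (forall i, kbound (K i) (M i)) ->
  kbound (fun x y => \sum_(i <- s) K i x y) (\sum_(i <- s) M i).
Proof.
move=> h; elim: s => [|i s IH].
  by rewrite big_nil; apply: kbound_ext kbound0 => x y; rewrite big_nil.
by rewrite big_cons; apply: kbound_ext (kboundD (h i) IH) => x y; rewrite big_cons.
Qed.

(** Weights depending on one variable are absorbed into xi and eta. *)
Lemma kbound_weight K M (a b : T -> C) : 0 <= M ->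
  (forall x, normc (a x) <= 1) -> (forall y, normc (b y) <= 1) ->
  kbound K M -> kbound (fun x y => K x y * a x * b y) M.
Proof.
move=> M0 ha hb h S xi eta.
have -> : bform (fun x y => K x y * a x * b y) S xi eta =
    bform K S (fun y => b y * xi y) (fun x => a x * eta x).
  by apply: eq_bigr => x _; apply: eq_bigr => y _; ring.
apply: le_trans (h _ _ _) _; rewrite ler_wpM2l// lerD// le_sqsum// => x;
  by rewrite normcM ler_piMl ?normc_ge0.
Qed.

Lemma kbound_adj K M : kbound K M -> kbound (fun x y => (K y x)^*%C) M.
Proof.
move=> h S xi eta.
have -> : bform (fun x y => (K y x)^*%C) S xi eta =
    (bform K S (fun x => (eta x)^*%C) (fun x => (xi x)^*%C))^*%C.
  rewrite /bform exchange_big rmorph_sum; apply: eq_bigr => x _.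
  rewrite rmorph_sum; apply: eq_bigr => y _ /=.
  by rewrite !rmorphM /= !conjcK mulrAC.
rewrite normc_conj addrC.
have := h S (fun x => (eta x)^*%C) (fun x => (xi x)^*%C).
by rewrite !(@sqsum_eq _ (fun x => (_ x)^*%C) _ (fun x => normc_conj _)).
Qed.

Lemma kbound_lim K M : (forall e, 0 < e -> kbound K (M + e)) -> kbound K M.
Proof.
move=> h S xi eta; apply/ler_addgt0Pl => e e0.
set s := sqsum S xi + sqsum S eta.
have s0 : 0 <= s by rewrite addr_ge0 ?sqsum_ge0.
have s1 : 0 < s + 1 by lra.
have /h /(_ S xi eta) : 0 < e / (s + 1) by rewrite divr_gt0.
have : e / (s + 1) * s <= e.
  by rewrite mulrAC ler_pdivrMr// ler_wpM2l ?ltW// ltrDl.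
by rewrite -/s mulrDl; lra.
Qed.

Lemma kbound_entry K M x y : kbound K M -> normc (K x y) <= M.
Proof.
move=> h.
have sd S z : z \in S -> sqsum S (fun w => (w == z)%:R) = 1.
  move=> zS; rewrite /sqsum (big_rem z zS)/= eqxx normc1 expr1n big_seq big1 ?addr0// => w.
  by rewrite mem_rem_uniq ?inE ?fset_uniq// => /andP[/negbTE -> _]; rewrite normc0 expr0n.
have := h [fset x; y]%fset (fun w => (w == y)%:R) (fun w => (w == x)%:R).
rewrite !sd ?inE ?eqxx ?orbT//.
rewrite /bform (big_rem x)/= ?inE ?eqxx// [X in normc (_ + X)]big1_seq ?addr0; last first.
  move=> w /andP[_]; rewrite mem_rem_uniq ?inE ?fset_uniq// => /andP[/negbTE -> _].
  by rewrite big1// => *; rewrite mulr0.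
rewrite (big_rem y)/= ?inE ?eqxx ?orbT// [X in normc (_ + X)]big1_seq ?addr0 ?mulr1; last first.
  move=> w /andP[_]; rewrite mem_rem_uniq ?inE ?fset_uniq// => /andP[/negbTE -> _].
  by rewrite mulr0 mul0r.
lra.
Qed.

Lemma kbound_ge0 K M (x : T) : kbound K M -> 0 <= M.
Proof. by move=> /(kbound_entry x x); apply: le_trans; exact: normc_ge0. Qed.

(** Division by l x - l y where l x >= 2s and l y <= s. Some finite bound N is
    assumed only to start an iteration that improves it; the final bound does
    not depend on N. *)
Lemma kbound_separated (lt : T -> R) K M (N s : R) : 0 < s -> 0 <= M -> 0 <= N ->
  (forall y, 0 <= lt y) ->
  (forall x y, K x y != 0 -> 2 * s <= lt x /\ lt y <= s) ->
  kbound K N ->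
  kbound (fun x y => (lt x - lt y)%:C%C * K x y) (s * M) -> kbound K M.
Proof.
move=> s0 M0 N0 lt0 sepK bN bM.
have s2 : 0 < 2 * s by rewrite mulr_gt0.
pose a x : R := if 2 * s <= lt x then 2 * s / lt x else 0.
pose b y : R := if lt y <= s then lt y / s else 0.
have a1 x : normc (a x)%:C%C <= 1.
  rewrite normc_real /a; case: ifP => h; last by rewrite normr0.
  have p : 0 < lt x by apply: lt_le_trans h.
  by rewrite ger0_norm ?divr_ge0 ?(ltW s2) ?(ltW p)// ler_pdivrMr// mul1r.
have b1 x : normc (b x)%:C%C <= 1.
  rewrite normc_real /b; case: ifP => h; last by rewrite normr0.
  by rewrite ger0_norm ?divr_ge0 ?(ltW s0)// ler_pdivrMr// mul1r.
pose c1 (x : T) : C := 1.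
have one1 x : normc (c1 x) <= 1 by rewrite normc1.
(* K = ((l x - l y) K) / l x + K (l y / l x): the first summand is at most M / 2
   in norm, and the weight l y / l x at most 1 / 2, so a bound N' for K improves
   to M / 2 + N' / 2. The iterates converge to M. *)
have step (N' : R) : 0 <= N' -> kbound K N' -> kbound K (M / 2 + N' / 2).
  move=> N'0 bN'.
  have h1 := kbound_weight (mulr_ge0 (ltW s0) M0) a1 one1 bM.
  have h2 := kbound_weight N'0 a1 b1 bN'.
  have := kboundD (kboundZ (2 * s)^-1%:C%C h1) (kboundZ 2^-1%:C%C h2).
  have -> : normc (2 * s)^-1%:C%C * (s * M) = M / 2.
    by rewrite normc_real ger0_norm ?invr_ge0 ?ltW//; field; rewrite gt_eqF.
  rewrite normc_real ger0_norm ?invr_ge0// [2^-1 * N']mulrC.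
  apply: kbound_ext => x y; have [->|/sepK[hx hy]] := eqVneq (K x y) 0.
    by rewrite !(mulr0, mul0r) addr0.
  have p : 0 < lt x by apply: lt_le_trans hx.
  rewrite /a hx /b hy /c1.
  transitivity (((2 * s)^-1 * (lt x - lt y) * (2 * s / lt x) +
     2^-1 * (2 * s / lt x) * (lt y / s))%:C%C * K x y).
    by rewrite !rmorphD !rmorphM /=; ring.
  rewrite [X in X%:C%C](_ : _ = 1) ?rmorph1 ?mul1r//.
  by field; rewrite !gt_eqF.
have iter n : kbound K (M + N / 2 ^+ n).
  elim: n => [|n IH]; first by rewrite expr0 divr1; apply: kbound_le bN; rewrite lerDr.
  apply: kbound_le (step _ _ IH); last by rewrite addr_ge0 ?divr_ge0 ?exprn_ge0.
  rewrite exprS invfM mulrA [N / 2]mulrC -mulrA; lra.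
apply: kbound_lim => e e0.
have [n hn] := exists_geometric_le N0 e0.
by apply: kbound_le (iter n); rewrite lerD2l.
Qed.

End Kernels.

(** * Translation and averaging of kernels on a group *)

Section GroupKernels.
Context {R : realType} {G : groupType}.
Local Notation C := R[i].
Implicit Types (S A B : {fset G}) (K : G -> G -> C) (M : R).
Local Open Scope group_scope.

Lemma kbound_transl K M g : kbound K M -> kbound (fun x y => K (x * g) (y * g)) M.
Proof.
move=> h S xi eta; pose S' := [fset x * g | x in S]%fset.
have E (V : nmodType) (F : G -> V) :
    (\sum_(x <- S) F (x * g)%g = \sum_(x <- S') F x)%R.
  rewrite [RHS](perm_big [seq x * g | x <- S]) ?big_map//=.
  apply: uniq_perm; rewrite ?fset_uniq//.
    by rewrite map_inj_uniq ?fset_uniq//; exact: mulIg.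
  by move=> x; apply/imfsetP/mapP => -[y yS ->]; exists y.
have Es z : sqsum S' (fun x => z (x * g^-1)) = sqsum S z.
  by rewrite /sqsum -E; apply: eq_bigr => x _; rewrite mulgK.
have := h S' (fun x => xi (x * g^-1)) (fun x => eta (x * g^-1)).
rewrite !Es (_ : bform _ S' _ _ = bform (fun x y => K (x * g) (y * g)) S xi eta)//.
rewrite /bform -E; apply: eq_bigr => x _; rewrite -E.
by apply: eq_bigr => y _; rewrite !mulgK.
Qed.

(** A family of kernels, one for each g in G, can be glued along the translates
    A g^-1 and B g^-1 : each point x lies in |A| of the former and each y in
    |B| of the latter, so in the arithmetic-geometric form the bounds add up to
    max(|A|, |B|). The g with y g = b in B are the y^-1 b. *)
Lemma kbound_avg (K : G -> G -> G -> C) A B M (N : R) : (0 <= M)%R ->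
  (forall g, kbound (K g) M) -> (#|` A|%:R <= N)%R -> (#|` B|%:R <= N)%R ->
  kbound (fun x y => \sum_(b <- B | (x * y^-1 * b)%g \in A) K (y^-1 * b)%g x y)%R
    (N * M).
Proof.
move=> M0 h hA hB S xi eta.
(* On the finite section S the multiplier is the sum over g in T of
   1_A(x g) 1_B(y g): for fixed y the admissible g are the y^-1 b. *)
pose T := [fset y^-1 * b | y in S, b in B]%fset.
pose iv (X : {fset G}) g (x : G) : C := ((x * g)%g \in X)%:R%R.
have -> : bform (fun x y =>
      \sum_(b <- B | (x * y^-1 * b)%g \in A) K (y^-1 * b)%g x y)%R S xi eta =
    (\sum_(g <- T) bform (K g) S (fun y => iv B g y * xi y)
      (fun x => iv A g x * eta x))%R.
  rewrite exchange_big; apply: eq_big_seq => x xS.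
  rewrite exchange_big; apply: eq_big_seq => y yS /=.
  have rT (F : G -> C) :
      (\sum_(b <- B) F (y^-1 * b)%g = \sum_(g <- T | (y * g)%g \in B) F g)%R.
    rewrite -[RHS]big_filter [RHS](perm_big [seq y^-1 * b | b <- B]) ?big_map//=.
    apply: uniq_perm.
    - by rewrite filter_uniq ?fset_uniq.
    - by rewrite map_inj_uniq ?fset_uniq//; exact: mulgI.
    move=> g; rewrite mem_filter; apply/andP/mapP => [[yg gT]|[b bB ->]].
      by exists (y * g) => //; rewrite mulKg.
    by rewrite mulVKg; split=> //; apply/imfset2P; exists y => //; exists b.
  rewrite big_mkcond /= !mulr_suml.
  pose F g : C := (K g x y * iv A g x * xi y * eta x)%R.
  transitivity (\sum_(b <- B) F (y^-1 * b)%g)%R.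
    apply: eq_bigr => b _; rewrite /F /iv mulgA.
    by case: (_ \in A); rewrite ?mulr1 ?mulr0 ?mul0r.
  rewrite rT big_mkcond /=; apply: eq_bigr => g _.
  by rewrite /F {2}/iv; case: (_ \in B); rewrite ?(mul1r, mul0r, mulr0)//; ring.
apply: (@le_trans _ _ (\sum_(g <- T) M * (sqsum S (fun y => iv B g y * xi y) +
     sqsum S (fun x => iv A g x * eta x)))%R).
  apply: (@le_trans _ _ (\sum_(g <- T) 2 * normc (bform (K g) S
      (fun y => iv B g y * xi y) (fun x => iv A g x * eta x)))%R).
    by rewrite -mulr_sumr ler_wpM2l// le_normc_sum.
  by apply: ler_sum => g _; exact: h.
have iv_sum (X : {fset G}) (z : G -> C) : (#|` X|%:R <= N ->
    \sum_(g <- T) sqsum S (fun y => iv X g y * z y) <= N * sqsum S z)%R.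
  move=> hX; rewrite exchange_big mulr_sumr /=; apply: ler_sum => y _.
  under eq_bigr do rewrite normcM exprMn.
  rewrite -mulr_suml ler_wpM2r ?sqr_ge0//; apply: le_trans hX.
  rewrite (_ : (\sum_(g <- T) _ = \sum_(g <- T | (y * g)%g \in X) 1)%R); last first.
    rewrite [RHS]big_mkcond; apply: eq_bigr => g _.
    by rewrite /iv; case: (_ \in X); rewrite ?normc1 ?normc0 ?expr1n ?expr0n.
  rewrite -big_filter big_const_seq count_predT iter_addr_0 ler_nat.
  rewrite -(size_map (fun g => y * g)); apply: uniq_leq_size.
    by rewrite map_inj_uniq ?filter_uniq ?fset_uniq//; exact: mulgI.
  by move=> w /mapP[g]; rewrite mem_filter => /andP[? _] ->.
rewrite -mulr_sumr big_split/= [(N * M)%R]mulrC -mulrA ler_wpM2l// mulrDr.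
by rewrite lerD ?iv_sum.
Qed.

End GroupKernels.

(** * Finite sections of square-summable functions *)

Section L2Finite.
Context {R : realType} {T : choiceType}.
Local Notation C := R[i].
Local Notation H := (l2 R T).
Implicit Types (S : {fset T}) (xi eta : H) (f g : T -> C).

Lemma sqnorm_leP f (M : R) : (sqnorm f <= M%:E)%E <-> forall S, sqsum S f <= M.
Proof.
split=> h => [S|].
  rewrite -lee_fin; apply: le_trans h; apply: esum_ge; exists [set` S]%classic.
    by split => //; exact: finite_fset.
  by rewrite fsbig_finite ?finite_fset// set_fsetK /sqsum sumEFin.
apply: ge_ereal_sup => _ [A [finA _] <-].
by rewrite fsbig_finite// sumEFin lee_fin h.
Qed.

Lemma square_summable_bound f (M : R) : (forall S, sqsum S f <= M) -> f \in square_summable.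
Proof. by move=> /sqnorm_leP h; rewrite unfold_in (le_lt_trans h)// ltry. Qed.

Lemma l2norm_leP xi (M : R) : 0 <= M ->
  l2norm xi <= M <-> forall S, sqsum S xi <= M ^+ 2.
Proof.
move=> M0; rewrite -sqnorm_leP -sqr_l2norm lee_fin.
by rewrite ler_sqr ?nnegrE ?l2norm_ge0.
Qed.

Lemma sqsum_le_l2norm S xi : sqsum S xi <= l2norm xi ^+ 2.
Proof. by have /l2norm_leP := lexx (l2norm xi); apply; exact: l2norm_ge0. Qed.

Lemma l2_sumE I (s : seq I) (F : I -> H) x :
  (\sum_(i <- s) F i) x = \sum_(i <- s) F i x.
Proof. by elim: s => [|i s IH]; rewrite ?big_nil// !big_cons -IH. Qed.

Lemma l2_subE xi eta x : (xi - eta) x = xi x - eta x.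
Proof. by []. Qed.

Lemma l2_addE xi eta x : (xi + eta) x = xi x + eta x.
Proof. by []. Qed.

Definition trunc S f : H := \sum_(y <- S) f y *: delta y.

Lemma truncE S f x : trunc S f x = if x \in S then f x else 0.
Proof.
rewrite l2_sumE.
transitivity (\sum_(y <- S) f y * (x == y)%:R); first by [].
case: ifPn => xS.
  rewrite (big_rem x xS)/= eqxx mulr1 big_seq big1 ?addr0// => w.
  by rewrite mem_rem_uniq ?inE ?fset_uniq// eq_sym => /andP[/negbTE -> _]; rewrite mulr0.
rewrite big_seq big1// => y yS; case: eqVneq => [e|]; last by rewrite mulr0.
by rewrite e yS in xS.
Qed.

Lemma sqsum_fsetU S S' f : sqsum (S `|` S')%fset f = sqsum S f + sqsum (S' `\` S)%fset f.
Proof.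
rewrite /sqsum (perm_big (enum_fset S ++ enum_fset (S' `\` S)%fset)) ?big_cat//.
apply: uniq_perm; first exact: fset_uniq.
  rewrite cat_uniq !fset_uniq andbT/=; apply/hasPn => x.
  by rewrite in_fsetD => /andP[].
by move=> x; rewrite mem_cat in_fsetU in_fsetD; case: (x \in S).
Qed.

Lemma sqsum_trunc S S' f : sqsum S' (trunc S f) = sqsum (S' `&` S)%fset f.
Proof.
transitivity (\sum_(x <- S' | x \in S) normc (f x) ^+ 2).
  rewrite [RHS]big_mkcond; apply: eq_bigr => x _.
  by rewrite truncE; case: ifP => //; rewrite normc0 expr0n.
by rewrite big_fset_condE; apply: eq_fbigl => x; rewrite !inE.
Qed.

Lemma sqsum_fsubset S S' f : (S `<=` S')%fset -> sqsum S f <= sqsum S' f.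
Proof.
move=> SS'; rewrite -(fsetUidPr _ _ SS') sqsum_fsetU lerDl; exact: sqsum_ge0.
Qed.

Lemma sqr_l2norm_trunc S f : l2norm (trunc S f) ^+ 2 = sqsum S f.
Proof.
apply/eqP; rewrite eq_le; apply/andP; split; last first.
  by apply: le_trans (sqsum_le_l2norm S _); rewrite sqsum_trunc fsetIid.
rewrite -(@sqr_sqrtr _ (sqsum S f)) ?sqsum_ge0// ler_sqr ?nnegrE ?l2norm_ge0 ?sqrtr_ge0//.
apply/l2norm_leP; rewrite ?sqrtr_ge0// => S'; rewrite sqr_sqrtr ?sqsum_ge0// sqsum_trunc.
by rewrite sqsum_fsubset// fsubsetIr.
Qed.

(** A finite set that nearly realizes the supremum defining the squared norm
    leaves a remainder of small norm. *)
Lemma trunc_dense xi (e : R) : 0 < e -> exists S, l2norm (xi - trunc S xi) <= e.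
Proof.
move=> e0; have [S hS] : exists S, l2norm xi ^+ 2 - e ^+ 2 <= sqsum S xi.
  apply: contrapT => /forallNP h.
  have : (sqnorm xi <= (l2norm xi ^+ 2 - e ^+ 2)%:E)%E.
    by apply/sqnorm_leP => S; have /negP := h S; rewrite -ltNge => /ltW.
  by rewrite -sqr_l2norm lee_fin; have := exprn_gt0 2 e0; lra.
exists S; apply/l2norm_leP => [|S']; first exact: ltW.
have := sqsum_le_l2norm (S `|` S')%fset xi; rewrite sqsum_fsetU.
suff -> : sqsum S' (xi - trunc S xi) = sqsum (S' `\` S)%fset xi by lra.
transitivity (\sum_(x <- S' | x \notin S) normc (xi x) ^+ 2).
  rewrite [RHS]big_mkcond; apply: eq_bigr => x _.
  rewrite l2_subE truncE.
  by rewrite if_neg; case: ifP => _; rewrite ?subrr ?subr0 ?normc0 ?expr0n.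
by rewrite big_fset_condE; apply: eq_fbigl => x; rewrite !inE andbC.
Qed.

End L2Finite.

(** * Operator norm and kernel of a bounded operator *)

Section OpnormKernel.
Context {R : realType} {G : groupType}.
Local Notation C := R[i].
Local Notation H := (l2 R G).
Implicit Types (S : {fset G}) (xi eta : H) (f g : G -> C) (u v : bop R G).

(** The kernel, or matrix, of an operator: its column y is the image of
    delta y. *)
Definition opker u x y : C := u (delta y) x.

Lemma opkerD u v x y : opker (u + v) x y = opker u x y + opker v x y.
Proof. by []. Qed.

Lemma opkerB u v x y : opker (u - v) x y = opker u x y - opker v x y.
Proof. by []. Qed.

Lemma opkerZ (c : C) u x y : opker (c *: u) x y = c * opker u x y.
Proof. by []. Qed.

Lemma opker_trunc u S f x : u (trunc S f) x = \sum_(y <- S) opker u x y * f y.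
Proof.
rewrite /trunc linear_sum l2_sumE; apply: eq_bigr => y _.
by rewrite linearZ mulrC.
Qed.

(** Sections with different sets of rows and columns follow from square ones by
    extending xi and eta by 0 to the union. *)
Lemma kbound_form2 (K : G -> G -> C) (M : R) S S' f g : kbound K M ->
  2 * normc (\sum_(x <- S') \sum_(y <- S) K x y * f y * g x) <=
  M * (sqsum S f + sqsum S' g).
Proof.
move=> h; pose U := (S `|` S')%fset.
have E X (F : G -> C) : (X `<=` U)%fset ->
    \sum_(x <- U | x \in X) F x = \sum_(x <- X) F x.
  move=> XU; rewrite big_fset_condE; apply: eq_fbigl => x.
  apply/idP/idP => [|xX]; first by rewrite !inE => /andP[].
  by have := fsubsetP XU x xX; rewrite !inE xX => ->.
have Es X (z : G -> C) : (X `<=` U)%fset -> sqsum U (fun x => (x \in X)%:R * z x) = sqsum X z.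
  move=> XU; have EX : (U `&` X)%fset = X by apply/fsetIidPr.
  rewrite -{2}EX -sqsum_trunc; apply: sqsum_eq => x; rewrite truncE.
  by case: ifP; rewrite ?mul1r ?mul0r.
rewrite -(Es S f) ?fsubsetUl// -(Es S' g) ?fsubsetUr//.
suff -> : \sum_(x <- S') \sum_(y <- S) K x y * f y * g x =
  bform K U (fun x => (x \in S)%:R * f x) (fun x => (x \in S')%:R * g x) by [].
rewrite -E ?fsubsetUr// big_mkcond; apply: eq_bigr => x _.
case: ifP => xS'; last by rewrite big1// => y _; rewrite mul0r mulr0.
rewrite -E ?fsubsetUl// big_mkcond; apply: eq_bigr => y _.
by case: ifP => yS; rewrite ?mul0r ?mulr0 ?mul0r ?mul1r.
Qed.

Lemma kbound_opker u (M : R) : 0 <= M ->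
  (forall xi, l2norm (u xi) <= M * l2norm xi) -> kbound (opker u) M.
Proof.
move=> M0 hM; apply: kbound_lim => e e0; have Me : 0 < M + e by lra.
move=> S f g; rewrite /bform.
under eq_bigr do rewrite -mulr_suml -opker_trunc.
apply: (@le_trans _ _ (2 * \sum_(x <- S) normc (u (trunc S f) x * g x))).
  by rewrite ler_wpM2l// le_normc_sum.
apply: (@le_trans _ _ ((M + e)^-1 * sqsum S (u (trunc S f)) + (M + e) * sqsum S g)).
  rewrite !mulr_sumr -big_split; apply: ler_sum => x _.
  exact: normc_mul_AMGM.
rewrite mulrDr lerD2r ler_pdivrMl// mulrA -expr2 -(sqr_l2norm_trunc S f) -exprMn.
apply: le_trans (sqsum_le_l2norm _ _) _.
rewrite ler_sqr ?nnegrE ?l2norm_ge0 ?mulr_ge0 ?l2norm_ge0 ?(ltW Me)//.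
by apply: le_trans (hM _) _; rewrite ler_wpM2r ?l2norm_ge0// lerDl ltW.
Qed.

Lemma kbound_apply (K : G -> G -> C) (M : R) S S' f : 0 <= M -> kbound K M ->
  sqsum S' (fun x => \sum_(y <- S) K x y * f y) <= M ^+ 2 * sqsum S f.
Proof.
move=> M0 hM; pose w x := \sum_(y <- S) K x y * f y; rewrite -/w.
set Q := sqsum S' _; have Q0 : 0 <= Q by exact: sqsum_ge0.
(* Testing against t times the conjugate of the image; t = 1 / M is optimal. *)
have test (t : R) : 0 <= t -> 2 * (t * Q) <= M * (sqsum S f + t ^+ 2 * Q).
  move=> t0; pose g x : C := t%:C%C * (w x)^*%C.
  have := kbound_form2 S S' f g hM.
  have -> : sqsum S' g = t ^+ 2 * Q.
    rewrite sqsumZ normc_real ger0_norm//; congr (_ * _).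
    by apply: sqsum_eq => x; rewrite normc_conj.
  under eq_bigr do rewrite -mulr_suml -/(w _) /g mulrCA normc_sqr.
  rewrite -mulr_sumr -rmorph_sum -rmorphM normc_real ger0_norm//.
  by rewrite mulr_ge0.
move: M0; rewrite le_eqVlt => /predU1P[M0|M0].
  by have := test 1 ler01; rewrite -M0; lra.
have := test M^-1; rewrite invr_ge0 (ltW M0) => /(_ isT).
rewrite -(@ler_pM2l _ (M^-1)) ?invr_gt0// mulKf ?gt_eqF// => h.
have : M^-1 ^+ 2 * Q <= sqsum S f by lra.
by rewrite exprVn ler_pdivrMl ?exprn_gt0.
Qed.

(** The bound holds on finitely supported vectors by [kbound_apply]. A vector is
    the sum of a truncation and a small remainder w, and
    |a + b|^2 <= (1 + d) |a|^2 + (1 + 1/d) |b|^2 lets the error of w vanish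
    without losing a factor in the bound. *)
Lemma opker_bound u (M : R) : 0 <= M -> kbound (opker u) M ->
  forall xi, l2norm (u xi) <= M * l2norm xi.
Proof.
move=> M0 hM.
have fin S S' f : sqsum S' (u (trunc S f)) <= M ^+ 2 * sqsum S f.
  apply: le_trans (kbound_apply S S' f M0 hM).
  by apply: le_sqsum => x; rewrite opker_trunc.
move=> xi; apply/l2norm_leP => [|S']; first by rewrite mulr_ge0 ?l2norm_ge0.
rewrite exprMn; set X := l2norm xi ^+ 2.
have [N N0 hN] := bop_bounded u.
apply/ler_addgt0Pl => e e0.
have X0 : 0 <= M ^+ 2 * X by rewrite mulr_ge0 ?sqr_ge0.
have [d d0 dE] : exists2 d, 0 < d & d * (1 + M ^+ 2 * X) = e.
  exists (e / (1 + M ^+ 2 * X)); first by rewrite divr_gt0//; lra.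
  by rewrite divfK// gt_eqF//; lra.
(* P makes the error of the truncation, inflated by 1 + 1 / d, at most d. *)
pose P := (1 + d^-1) * N ^+ 2 + 1.
have P0 : 0 < P by rewrite /P ltr_wpDl// mulr_ge0 ?sqr_ge0// addr_ge0 ?invr_ge0 ?ltW.
have sP0 : 0 < Num.sqrt (d / P) by rewrite sqrtr_gt0 divr_gt0.
have [S hS] := trunc_dense xi sP0.
set w := xi - trunc S xi in hS.
have pt (a b : C) : normc (a + b) ^+ 2 <= (1 + d) * normc a ^+ 2 + (1 + d^-1) * normc b ^+ 2.
  apply: (@le_trans _ _ ((normc a + normc b) ^+ 2)).
    by rewrite ler_sqr ?nnegrE ?addr_ge0 ?normc_ge0// le_normcD.
  have dn : d != 0 by rewrite gt_eqF.
  rewrite -subr_ge0 [X in 0 <= X](_ : _ = d^-1 * (d * normc a - normc b) ^+ 2).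
    by rewrite mulr_ge0 ?sqr_ge0// invr_ge0 ltW.
  by field.
have -> : sqsum S' (u xi) = sqsum S' (fun x => u (trunc S xi) x + u w x).
  by apply: sqsum_eq => x; rewrite -[xi in LHS](subrK (trunc S xi)) addrC linearD.
apply: (@le_trans _ _ ((1 + d) * sqsum S' (u (trunc S xi)) + (1 + d^-1) * sqsum S' (u w))).
  by rewrite /sqsum !mulr_sumr -big_split; apply: ler_sum => x _; exact: pt.
have h1 : sqsum S' (u (trunc S xi)) <= M ^+ 2 * X.
  by apply: le_trans (fin _ _ _) _; rewrite ler_wpM2l ?sqr_ge0// sqsum_le_l2norm.
have h2 : (1 + d^-1) * sqsum S' (u w) <= d.
  apply: (@le_trans _ _ ((1 + d^-1) * (N ^+ 2 * (d / P)))).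
    rewrite ler_wpM2l ?addr_ge0 ?invr_ge0 ?(ltW d0)//.
    apply: le_trans (sqsum_le_l2norm _ _) _.
    apply: (@le_trans _ _ ((N * l2norm w) ^+ 2)).
      by rewrite ler_sqr ?nnegrE ?mulr_ge0 ?l2norm_ge0.
    rewrite exprMn ler_wpM2l ?sqr_ge0// -(@sqr_sqrtr _ (d / P)) ?(ltW (divr_gt0 d0 P0))//.
    by rewrite ler_sqr ?nnegrE ?l2norm_ge0 ?sqrtr_ge0.
  rewrite !mulrA ler_pdivrMr// -subr_ge0.
  rewrite [X in 0 <= X](_ : _ = d); first exact: ltW.
  by rewrite /P; field; rewrite gt_eqF.
have h3 : (1 + d) * sqsum S' (u (trunc S xi)) <= (1 + d) * (M ^+ 2 * X).
  by rewrite ler_wpM2l// addr_ge0// ltW.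
move: dE h2 h3; set A := M ^+ 2 * X; rewrite mulrDr mulr1 => dE h2 h3.
have : (1 + d) * A = A + d * A by rewrite mulrDl mul1r.
lra.
Qed.

Lemma opnorm_kbound u (M : R) : 0 <= M -> (opnorm u <= M%:E)%E <-> kbound (opker u) M.
Proof.
move=> M0; rewrite (opnorm_leP u M0); split; first exact: kbound_opker.
exact: opker_bound.
Qed.

Lemma opker_inj u v : (forall x y, opker u x y = opker v x y) -> u = v.
Proof.
move=> h; apply/eqP; rewrite -subr_eq0; apply/eqP; apply: bop_inj => xi.
apply: l2norm0_eq0; apply/eqP; rewrite eq_le l2norm_ge0 andbT.
rewrite -(mul0r (l2norm xi)); apply: opker_bound => //.
apply: kbound_ext (kbound0 (T := G)) => x y.
by rewrite opkerB h subrr.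
Qed.

Lemma kbound_opker_exists u : exists2 M : R, 0 <= M & kbound (opker u) M.
Proof. by have [M M0 /(kbound_opker M0)] := bop_bounded u; exists M. Qed.

Lemma opnorm_ge0 u : (0 <= opnorm u)%E.
Proof.
apply: ereal_sup_ubound; exists 0; rewrite /= ?l2norm0//.
by rewrite linear0 l2norm0.
Qed.

Lemma opnorm_fin u : opnorm u \is a fin_num.
Proof.
rewrite ge0_fin_numE ?opnorm_ge0//; have [M M0 /opnorm_kbound h] := kbound_opker_exists u.
by apply: le_lt_trans (h M0) _; exact: ltry.
Qed.

Definition nrm u : R := fine (opnorm u).

Lemma nrmE u : opnorm u = (nrm u)%:E.
Proof. by rewrite fineK ?opnorm_fin. Qed.

Lemma nrm_ge0 u : 0 <= nrm u.
Proof. by rewrite fine_ge0 ?opnorm_ge0. Qed.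

Lemma nrm_kbound u (M : R) : 0 <= M -> nrm u <= M <-> kbound (opker u) M.
Proof. by move=> M0; rewrite -opnorm_kbound// nrmE lee_fin. Qed.

Lemma kbound_nrm u : kbound (opker u) (nrm u).
Proof. by apply/nrm_kbound; rewrite ?nrm_ge0. Qed.

Lemma nrmP u xi : l2norm (u xi) <= nrm u * l2norm xi.
Proof. by apply: opker_bound (kbound_nrm _) _; exact: nrm_ge0. Qed.

Lemma nrm_leP u (M : R) : 0 <= M ->
  nrm u <= M <-> (forall xi, l2norm (u xi) <= M * l2norm xi).
Proof. by move=> M0; rewrite -opnorm_leP// nrmE lee_fin. Qed.

Lemma nrmD u v : nrm (u + v) <= nrm u + nrm v.
Proof.
apply/nrm_kbound; first by rewrite addr_ge0 ?nrm_ge0.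
exact: kboundD (kbound_nrm _) (kbound_nrm _).
Qed.

Lemma nrmZ (c : C) u : nrm (c *: u) = normc c * nrm u.
Proof.
have leZ d w : nrm (d *: w) <= normc d * nrm w.
  apply/nrm_kbound; first by rewrite mulr_ge0 ?nrm_ge0 ?normc_ge0.
  exact: kboundZ (kbound_nrm _).
apply/eqP; rewrite eq_le leZ/=; have [->|c0] := eqVneq c 0.
  by rewrite normc0 mul0r nrm_ge0.
have p : 0 < normc c.
  rewrite lt_neqAle normc_ge0 andbT eq_sym.
  by apply: contra c0 => /eqP/eq0_normc ->.
have := leZ c^-1 (c *: u); rewrite scalerA mulVf// scale1r normcV.
by rewrite ler_pdivlMl.
Qed.

Lemma nrmN u : nrm (- u) = nrm u.
Proof. by rewrite -scaleN1r nrmZ normcN normc1 mul1r. Qed.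

Lemma nrmB u v : nrm (u - v) <= nrm u + nrm v.
Proof. by rewrite -(nrmN v) nrmD. Qed.

Lemma nrm0 : nrm 0 = 0.
Proof. by rewrite -(scale0r (0 : bop R G)) nrmZ normc0 mul0r. Qed.

Lemma nrm_distC u v : nrm (u - v) = nrm (v - u).
Proof. by rewrite -nrmN opprB. Qed.

Lemma nrmM u v : nrm (u * v) <= nrm u * nrm v.
Proof.
apply/nrm_leP => [|xi]; first by rewrite mulr_ge0 ?nrm_ge0.
apply: le_trans (nrmP u (v xi)) _.
by rewrite -mulrA ler_wpM2l ?nrm_ge0 ?nrmP.
Qed.

Lemma nrm0_eq0 u : nrm u <= 0 -> u = 0.
Proof.
move=> h; apply: opker_inj => x y; apply: eq0_normc; apply/eqP.
by rewrite eq_le normc_ge0 andbT; apply: kbound_entry; apply/nrm_kbound.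
Qed.

End OpnormKernel.

(** * Unordered sums and the inner product *)

Section UnorderedSums.
Context {R : realType} {T : choiceType}.
Local Notation C := R[i].
Implicit Types (S : {fset T}) (g h : T -> C) (v w z : C).

(** Convergence along the finite subsets. The algebra of [csum] and of the inner
    product is derived from uniqueness of such limits, which avoids positive and
    negative parts. *)
Definition has_sum g v := forall e : R, 0 < e -> exists S, forall S',
  (S `<=` S')%fset -> normc (v - \sum_(x <- S') g x) <= e.

Lemma normc_small z : (forall e : R, 0 < e -> normc z <= e) -> z = 0.
Proof.
move=> h; apply: eq0_normc; apply/eqP; rewrite eq_le normc_ge0 andbT.
by apply/ler_addgt0Pl => e e0; rewrite addr0 h.
Qed.

Lemma has_sum_bound g v (M : R) : has_sum g v ->
  (forall S, normc (\sum_(x <- S) g x) <= M) -> normc v <= M.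
Proof.
move=> gv hM; apply/ler_addgt0Pl => e /gv[S /(_ S (fsubset_refl _)) hS].
rewrite -[v](subrK (\sum_(x <- S) g x)); apply: le_trans (le_normcD _ _) _.
by rewrite lerD.
Qed.

Lemma has_sumD g h v w : has_sum g v -> has_sum h w ->
  has_sum (fun x => g x + h x) (v + w).
Proof.
move=> gv hw e e0; have e2 : 0 < e / 2 by rewrite divr_gt0.
have [S hS] := gv _ e2; have [S1 hS1] := hw _ e2.
exists (S `|` S1)%fset => S' SS'; rewrite big_split/= opprD addrACA.
apply: le_trans (le_normcD _ _) _; rewrite [leRHS]splitr lerD//.
  by apply: hS; apply: fsubset_trans SS'; exact: fsubsetUl.
by apply: hS1; apply: fsubset_trans SS'; exact: fsubsetUr.
Qed.

Lemma has_sumZ (c : C) g v : has_sum g v -> has_sum (fun x => c * g x) (c * v).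
Proof.
move=> gv e e0; have c1 : 0 < normc c + 1 by rewrite ltr_wpDl ?normc_ge0.
have [S hS] := gv (e / (normc c + 1)) (divr_gt0 e0 c1).
exists S => S' /hS h; rewrite -mulr_sumr -mulrBr normcM.
apply: (@le_trans _ _ ((normc c + 1) * (e / (normc c + 1)))).
  by rewrite ler_pM ?normc_ge0// lerDl.
by rewrite mulrC divfK// gt_eqF.
Qed.

Lemma has_sum_conj g v : has_sum g v -> has_sum (fun x => (g x)^*%C) (v^*%C).
Proof.
move=> gv e /gv[S hS]; exists S => S' /hS.
by rewrite -normc_conj rmorphB rmorph_sum.
Qed.

Lemma has_sum_uniq g v w : has_sum g v -> has_sum g w -> v = w.
Proof.
move=> gv gw; apply/eqP; rewrite -subr_eq0; apply/eqP; apply: normc_small => e e0.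
have e2 : 0 < e / 2 by rewrite divr_gt0.
have [S hS] := gv _ e2; have [S1 hS1] := gw _ e2.
have h1 := hS _ (fsubsetUl S S1); have h2 := hS1 _ (fsubsetUr S S1).
set s := \sum_(x <- _) _ in h1 h2.
rewrite (_ : v - w = (v - s) - (w - s)); last by rewrite opprB addrA subrK.
by apply: le_trans (normcB _ _) _; rewrite [leRHS]splitr lerD.
Qed.

Lemma has_sum_finite g S : (forall x, x \notin S -> g x = 0) ->
  has_sum g (\sum_(x <- S) g x).
Proof.
move=> g0 e e0; exists S => S' SS'.
rewrite (_ : \sum_(x <- S') g x = \sum_(x <- S) g x) ?subrr ?normc0 ?ltW//.
rewrite (bigID (mem S))/= [X in _ + X]big1// addr0 big_fset_condE.
apply: eq_fbigl => x; apply/idP/idP => [|xS]; first by rewrite !inE => /andP[].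
by rewrite !inE xS (fsubsetP SS' x xS).
Qed.

Lemma ge0_esum_sum (f : T -> R) (M : R) : (forall x, 0 <= f x) ->
  (forall S, \sum_(x <- S) f x <= M) ->
  forall e : R, 0 < e -> exists S, forall S', (S `<=` S')%fset ->
    `|fine (\esum_(x in [set: T]) (f x)%:E) - \sum_(x <- S') f x| <= e.
Proof.
move=> f0 hM.
(* A nonnegative summable function is the square of an element of l2, so that
   density of the truncations applies. *)
pose g x : C := (Num.sqrt (f x))%:C%C.
have sqE S : sqsum S g = \sum_(x <- S) f x.
  by apply: eq_bigr => x _; rewrite normc_real ger0_norm ?sqrtr_ge0// sqr_sqrtr.
have gP : g \in square_summable.
  by apply: (@square_summable_bound _ _ _ M) => S; rewrite sqE.
have -> : \esum_(x in [set: T]) (f x)%:E = sqnorm (L2 gP).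
  apply: eq_esum => x _; congr EFin; transitivity (normc (g x) ^+ 2) => //.
  by rewrite normc_real ger0_norm ?sqrtr_ge0// sqr_sqrtr.
rewrite -sqr_l2norm /=; set xi := L2 gP.
move=> e e0; have se0 : 0 < Num.sqrt e by rewrite sqrtr_gt0.
have [S hS] := trunc_dense xi se0; exists S => S' SS'.
rewrite -sqE ger0_norm ?subr_ge0 ?(sqsum_le_l2norm S' xi)//.
rewrite lerBlDr; apply: (@le_trans _ _ (e + sqsum S g)); last first.
  by rewrite lerD2l sqsum_fsubset.
rewrite -(@sqr_sqrtr _ (_ + _)) ?addr_ge0 ?sqsum_ge0 ?(ltW e0)//.
rewrite ler_sqr ?nnegrE ?l2norm_ge0 ?sqrtr_ge0//.
apply/l2norm_leP => [|S1]; rewrite ?sqrtr_ge0// sqr_sqrtr ?addr_ge0 ?sqsum_ge0 ?(ltW e0)//.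
apply: (@le_trans _ _ (sqsum (S `|` S1)%fset xi)); first by rewrite sqsum_fsubset// fsubsetUr.
rewrite sqsum_fsetU addrC lerD2r.
apply: (@le_trans _ _ (l2norm (xi - trunc S xi) ^+ 2)); last first.
  rewrite -(@sqr_sqrtr _ e) ?(ltW e0)//.
  by rewrite ler_sqr ?nnegrE ?l2norm_ge0 ?sqrtr_ge0.
apply: le_trans (sqsum_le_l2norm (S1 `\` S)%fset _); rewrite /sqsum.
rewrite big_seq [leRHS]big_seq; apply: ler_sum => x.
by rewrite in_fsetD l2_subE truncE => /andP[/negbTE -> _]; rewrite subr0.
Qed.

Lemma rsum_sum (f : T -> R) (M : R) :
  (forall S, \sum_(x <- S) `|f x| <= M) ->
  forall e : R, 0 < e -> exists S, forall S', (S `<=` S')%fset ->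
    `|rsum f - \sum_(x <- S') f x| <= e.
Proof.
move=> hM; pose fp x := Num.max (f x) 0; pose fn x := Num.max (- f x) 0.
have fp0 x : 0 <= fp x by rewrite le_max lexx orbT.
have fn0 x : 0 <= fn x by rewrite le_max lexx orbT.
have fpn x : f x = fp x - fn x.
  by rewrite /fp /fn; case: (lerP (f x) 0); case: (lerP (- f x) 0); lra.
have pM S : \sum_(x <- S) fp x <= M.
  apply: le_trans (hM S); apply: ler_sum => x _.
  by rewrite ge_max normr_ge0 ler_norm.
have nM S : \sum_(x <- S) fn x <= M.
  apply: le_trans (hM S); apply: ler_sum => x _.
  by rewrite ge_max normr_ge0 -normrN ler_norm.
have -> : rsum f = fine (\esum_(x in [set: T]) (fp x)%:E) -
    fine (\esum_(x in [set: T]) (fn x)%:E).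
  congr (fine _ - fine _); apply: eq_esum => x _.
    by rewrite funeposE /= EFin_max.
  by rewrite funenegE /= EFin_max.
move=> e e0; have e2 : 0 < e / 2 by rewrite divr_gt0.
have [S hS] := ge0_esum_sum fp0 pM e2; have [S1 hS1] := ge0_esum_sum fn0 nM e2.
exists (S `|` S1)%fset => S' SS'.
have h1 := hS S' (fsubset_trans (fsubsetUl _ _) SS').
have h2 := hS1 S' (fsubset_trans (fsubsetUr _ _) SS').
under eq_bigr do rewrite fpn.
rewrite sumrB; move: h1 h2; rewrite !ler_norml; lra.
Qed.

Lemma has_sum_csum g (M : R) : (forall S, \sum_(x <- S) normc (g x) <= M) ->
  has_sum g (csum g).
Proof.
move=> hM e e0; have e2 : 0 < e / 2 by rewrite divr_gt0.
have reM S : \sum_(x <- S) `|complex.Re (g x)| <= M.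
  by apply: le_trans (hM S); apply: ler_sum => x _; exact: normc_Re.
have imM S : \sum_(x <- S) `|complex.Im (g x)| <= M.
  by apply: le_trans (hM S); apply: ler_sum => x _; exact: normc_Im.
have [S hS] := rsum_sum reM e2; have [S1 hS1] := rsum_sum imM e2.
exists (S `|` S1)%fset => S' SS'.
have h1 := hS S' (fsubset_trans (fsubsetUl _ _) SS').
have h2 := hS1 S' (fsubset_trans (fsubsetUr _ _) SS').
apply: le_trans (normc_ReIm _) _; rewrite [leRHS]splitr lerD//.
  by rewrite raddfB raddf_sum.
by rewrite raddfB raddf_sum.
Qed.

End UnorderedSums.

Section Inner.
Context {R : realType} {T : choiceType}.
Local Notation C := R[i].
Local Notation H := (l2 R T).
Implicit Types (S : {fset T}) (xi eta : H) (c : C).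

Lemma inner_summable S xi eta (M : R) : 0 < M ->
  2 * \sum_(x <- S) normc (xi x * (eta x)^*%C) <=
  M^-1 * l2norm xi ^+ 2 + M * l2norm eta ^+ 2.
Proof.
move=> M0; apply: (@le_trans _ _ (M^-1 * sqsum S xi + M * sqsum S eta)).
  rewrite !mulr_sumr -big_split; apply: ler_sum => x _ /=.
  by rewrite -[normc (eta x)]normc_conj normc_mul_AMGM.
by rewrite lerD// ler_wpM2l ?sqsum_le_l2norm ?invr_ge0 ?ltW.
Qed.

Lemma has_sum_inner xi eta : has_sum (fun x => xi x * (eta x)^*%C) (inner xi eta).
Proof.
apply: (@has_sum_csum _ _ _ (1 * l2norm xi ^+ 2 + 1 * l2norm eta ^+ 2)) => S.
have := inner_summable S xi eta ltr01; rewrite invr1.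
have : 0 <= \sum_(x <- S) normc (xi x * (eta x)^*%C).
  by apply: sumr_ge0 => x _; exact: normc_ge0.
lra.
Qed.

Lemma innerDl xi xi' eta : inner (xi + xi') eta = inner xi eta + inner xi' eta.
Proof.
apply: has_sum_uniq (has_sum_inner _ _) _.
have := has_sumD (has_sum_inner xi eta) (has_sum_inner xi' eta).
by congr has_sum; apply/funext => x; rewrite -mulrDl.
Qed.

Lemma innerZl c xi eta : inner (c *: xi) eta = c * inner xi eta.
Proof.
apply: has_sum_uniq (has_sum_inner _ _) _.
have := has_sumZ c (has_sum_inner xi eta).
by congr has_sum; apply/funext => x; rewrite mulrA.
Qed.

Lemma innerC xi eta : inner eta xi = (inner xi eta)^*%C.
Proof.
apply: has_sum_uniq (has_sum_inner _ _) _.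
have := has_sum_conj (has_sum_inner xi eta).
by congr has_sum; apply/funext => x; rewrite rmorphM /= conjcK mulrC.
Qed.

Lemma innerDr xi eta eta' : inner xi (eta + eta') = inner xi eta + inner xi eta'.
Proof. by rewrite innerC innerDl rmorphD [inner xi eta]innerC [inner xi eta']innerC. Qed.

Lemma innerZr c xi eta : inner xi (c *: eta) = c^*%C * inner xi eta.
Proof. by rewrite innerC innerZl rmorphM [inner xi eta]innerC. Qed.

Lemma inner_deltar xi x : inner xi (delta x) = xi x.
Proof.
apply: has_sum_uniq (has_sum_inner _ _) _.
have := @has_sum_finite _ _ (fun y => xi y * ((delta x : H) y)^*%C) [fset x]%fset.
rewrite big_seq_fset1 /= eqxx conjc1 mulr1; apply => y.
by rewrite inE => /negbTE ->; rewrite conjc0 mulr0.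
Qed.

Lemma inner_deltal eta x : inner (delta x) eta = (eta x)^*%C.
Proof. by rewrite innerC inner_deltar. Qed.

Lemma inner_CS xi eta : normc (inner xi eta) <= l2norm xi * l2norm eta.
Proof.
apply/ler_addgt0Pl => e e0; set a := l2norm xi; set b := l2norm eta.
have a0 : 0 <= a by exact: l2norm_ge0.
have b0 : 0 <= b by exact: l2norm_ge0.
have main (M : R) : 0 < M -> 2 * normc (inner xi eta) <= M^-1 * a ^+ 2 + M * b ^+ 2.
  move=> M0.
  rewrite -ler_pdivlMl//; apply: has_sum_bound (has_sum_inner _ _) _ => S.
  apply: le_trans (le_normc_sum _ _ _) _; rewrite ler_pdivlMl//.
  exact: inner_summable.
have [ab|ab] := eqVneq (a * b) 0.
  have z : inner xi eta = 0.
    move/eqP: ab; rewrite mulf_eq0 => /orP[]/eqP/l2norm0_eq0 ->.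
      by rewrite -(scale0r 0) innerZl mul0r.
    by rewrite -(scale0r 0) innerZr conjc0 mul0r.
  by rewrite z normc0 ab addr0 ltW.
have [an bn] : a != 0 /\ b != 0 by move: ab; rewrite mulf_eq0 negb_or => /andP.
have ap : 0 < a by rewrite lt_neqAle eq_sym an.
have bp : 0 < b by rewrite lt_neqAle eq_sym bn.
(* The weight for which the two terms of the bound are equal. *)
have := main (a / b) (divr_gt0 ap bp).
rewrite (_ : (a / b)^-1 * a ^+ 2 = a * b); last by field; rewrite an bn.
rewrite (_ : a / b * b ^+ 2 = a * b); last by field.
lra.
Qed.

(** Only additivity is asked of F, so that the lemma serves for linear and for
    conjugate-linear functionals. *)
Lemma vanish_on_deltas (F : H -> C) :
  (forall xi eta, F (xi + eta) = F xi + F eta) ->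
  (forall c x, F (c *: delta x) = 0) ->
  (exists N : R, forall xi, normc (F xi) <= N * l2norm xi) ->
  forall xi, F xi = 0.
Proof.
move=> FD F0 [N hN] xi; apply: normc_small => e e0.
have N1 : 0 < `|N| + 1 by rewrite ltr_wpDl.
have [S hS] := trunc_dense xi (divr_gt0 e0 N1).
have Ft : F (trunc S xi) = 0.
  rewrite /trunc; elim: (enum_fset S) => [|y s IH].
    have := FD 0 0; rewrite addr0 big_nil => /eqP.
    by rewrite -subr_eq subrr eq_sym => /eqP.
  by rewrite big_cons FD F0 IH addr0.
rewrite -[xi](subrK (trunc S xi)) FD Ft addr0; apply: le_trans (hN _) _.
apply: (@le_trans _ _ ((`|N| + 1) * (e / (`|N| + 1)))).
  apply: (@le_trans _ _ ((`|N| + 1) * l2norm (xi - trunc S xi))).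
    rewrite ler_wpM2r ?l2norm_ge0//; apply: le_trans (ler_norm N) _.
    by rewrite lerDl.
  by rewrite ler_wpM2l// ltW.
by rewrite mulrC divfK// gt_eqF.
Qed.

End Inner.

(** * Operators defined by kernels: adjoints and completeness *)

Section KernelOperators.
Context {R : realType} {G : groupType}.
Local Notation C := R[i].
Local Notation H := (l2 R G).
Implicit Types (S : {fset G}) (K : G -> G -> C) (xi eta : H) (u v : bop R G).

(** The rows of a bounded kernel are square summable: test against the conjugate
    of a row. *)
Lemma kernel_row_summable K (M : R) x xi S : 0 < M -> kbound K M ->
  \sum_(y <- S) normc (K x y * xi y) <= M ^+ 2 + l2norm xi ^+ 2.
Proof.
move=> M0 hK; set Q := sqsum S (K x).
have Q0 : 0 <= Q by exact: sqsum_ge0.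
have QM : Q <= M ^+ 2.
  have := kbound_form2 S [fset x]%fset (fun y => M^-1%:C%C * (K x y)^*%C) (fun=> 1) hK.
  rewrite big_seq_fset1 sqsumZ {2}/sqsum big_seq_fset1 normc1 expr1n.
  rewrite (_ : \sum_(y <- S) _ = (M^-1 * Q)%:C%C); last first.
    rewrite rmorphM rmorph_sum mulr_sumr; apply: eq_bigr => y _.
    by rewrite mulr1 mulrCA normc_sqr.
  rewrite (@sqsum_eq _ _ S (fun y => (K x y)^*%C) (K x)) => [|y]; last exact: normc_conj.
  rewrite !normc_real !ger0_norm ?mulr_ge0 ?invr_ge0 ?(ltW M0)//.
  rewrite -/Q -(@ler_pM2l _ M)//.
  rewrite (_ : M * (2 * (M^-1 * Q)) = 2 * Q); last by field; rewrite gt_eqF.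
  rewrite (_ : M * (M * (M^-1 ^+ 2 * Q + 1)) = Q + M ^+ 2); last by field; rewrite gt_eqF.
  lra.
have h : 2 * \sum_(y <- S) normc (K x y * xi y) <= Q + l2norm xi ^+ 2.
  apply: (@le_trans _ _ (Q + sqsum S xi)); last by rewrite lerD2l sqsum_le_l2norm.
  rewrite mulr_sumr -big_split; apply: ler_sum => y _ /=.
  by have := normc_mul_AMGM (K x y) (xi y) ltr01; rewrite invr1 !mul1r.
have : 0 <= \sum_(y <- S) normc (K x y * xi y) by apply: sumr_ge0 => y _; exact: normc_ge0.
lra.
Qed.

(** Existence of operators from bounds on their matrices. The image of xi is
    defined row by row as an unordered sum; it is square summable because its
    finite sections are limits of those of truncations of xi. *)
Lemma kernel_bop K (M : R) : 0 <= M -> kbound K M ->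
  exists v : bop R G, forall x y, opker v x y = K x y.
Proof.
move=> M0 hK; pose N := M + 1; have N0 : 0 < N by rewrite ltr_wpDl.
have hN : kbound K N by apply: kbound_le hK; rewrite lerDl.
pose w xi x : C := csum (fun y => K x y * xi y).
have ws xi x : has_sum (fun y => K x y * xi y) (w xi x).
  by apply: has_sum_csum => S; exact: kernel_row_summable N0 hN.
have wb xi S' : sqsum S' (w xi) <= 2 * N ^+ 2 * l2norm xi ^+ 2.
  apply/ler_addgt0Pl => e e0.
  pose c : R := 2 * (size (enum_fset S'))%:R + 1.
  have c0 : 0 < c by rewrite ltr_wpDl// mulr_ge0.
  have d0 : 0 < e / c by rewrite divr_gt0.
  have sd0 : 0 < Num.sqrt (e / c) by rewrite sqrtr_gt0.
  have [S hS] : exists S, forall x, x \in enum_fset S' ->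
      normc (w xi x - \sum_(y <- S) K x y * xi y) <= Num.sqrt (e / c).
    suff [S hS] : exists S0, forall S, (S0 `<=` S)%fset ->
        forall x, x \in enum_fset S' ->
        normc (w xi x - \sum_(y <- S) K x y * xi y) <= Num.sqrt (e / c).
      by exists S; apply: hS; exact: fsubset_refl.
    elim: (enum_fset S') => [|x s [S0 IH]]; first by exists fset0.
    have [S1 h1] := ws xi x _ sd0; exists (S0 `|` S1)%fset => S hS z.
    rewrite inE => /predU1P[->|zs].
      by apply: h1; apply: fsubset_trans hS; exact: fsubsetUr.
    by apply: IH => //; apply: fsubset_trans hS; exact: fsubsetUl.
  pose p x := \sum_(y <- S) K x y * xi y.
  have h1 : sqsum S' p <= N ^+ 2 * sqsum S xi := kbound_apply S S' xi (ltW N0) hN.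
  have h2 : sqsum S' (w xi) <= \sum_(x <- S') (2 * (e / c) + 2 * normc (p x) ^+ 2).
    rewrite /sqsum big_seq [leRHS]big_seq; apply: ler_sum => x /hS hx.
    rewrite -[w xi x](subrK (p x)); apply: le_trans (normcD2 _ _) _.
    rewrite mulrDr lerD2r ler_wpM2l// -(@sqr_sqrtr _ (e / c)) ?(ltW d0)//.
    by rewrite ler_sqr ?nnegrE ?normc_ge0 ?sqrtr_ge0.
  apply: le_trans h2 _; rewrite big_split/= -[X in _ + X]mulr_sumr -/(sqsum S' p).
  have h3 : N ^+ 2 * sqsum S xi <= N ^+ 2 * l2norm xi ^+ 2.
    by rewrite ler_wpM2l ?sqr_ge0 ?sqsum_le_l2norm.
  rewrite big_const_seq count_predT iter_addr_0.
  have : (2 * (e / c)) *+ size (enum_fset S') <= e.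
    rewrite -mulr_natl (_ : _ * _ = e * (2 * (size (enum_fset S'))%:R) / c); last by ring.
    by rewrite ler_pdivrMr// ler_wpM2l ?(ltW e0)// lerDl.
  lra.
have wl2 xi : w xi \in square_summable := square_summable_bound (wb xi).
have wbl : (fun xi => L2 (wl2 xi)) \in @bounded_linear R G.
  apply/asboolP; split.
    move=> c xi eta; apply: l2_inj => x /=.
    apply: has_sum_uniq (ws _ _) _.
    have := has_sumD (has_sumZ c (ws xi x)) (ws eta x).
    by congr has_sum; apply/funext => y; rewrite mulrCA -mulrDr.
  exists (2 * N) => xi; have N2 : 0 <= 2 * N * l2norm xi.
    by rewrite !mulr_ge0 ?l2norm_ge0 ?(ltW N0).
  apply/l2norm_leP => // S; apply: le_trans (wb _ _) _.
  have : 0 <= N ^+ 2 * l2norm xi ^+ 2 by rewrite mulr_ge0 ?sqr_ge0.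
  by lra.
exists (Bop wbl) => x y; rewrite /opker /=.
apply: has_sum_uniq (ws _ _) _.
have := @has_sum_finite _ _ (fun z => K x z * ((delta y : H) z)) [fset y]%fset.
rewrite big_seq_fset1 /= eqxx mulr1; apply => z.
by rewrite inE => /negbTE ->; rewrite mulr0.
Qed.

(** A finite section only sees finitely many entries, hence bounds pass to
    entrywise limits. *)
Lemma kbound_approx K (M : R) :
  (forall e : R, 0 < e -> exists2 K', kbound K' M &
     forall x y, normc (K x y - K' x y) <= e) -> kbound K M.
Proof.
move=> h S xi eta; apply/ler_addgt0Pl => e e0.
pose W : R := 2 * \sum_(x <- S) \sum_(y <- S) normc (xi y) * normc (eta x) + 1.
have W0 : 0 < W.
  rewrite ltr_wpDl// mulr_ge0// sumr_ge0// => x _; rewrite sumr_ge0// => y _.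
  by rewrite mulr_ge0 ?normc_ge0.
have [K' bK' hK'] := h (e / W) (divr_gt0 e0 W0).
have E : bform K S xi eta = bform K' S xi eta +
    \sum_(x <- S) \sum_(y <- S) (K x y - K' x y) * xi y * eta x.
  rewrite -big_split; apply: eq_bigr => x _; rewrite -big_split.
  by apply: eq_bigr => y _ /=; ring.
rewrite E; apply: (@le_trans _ _ (2 * normc (bform K' S xi eta) +
   2 * normc (\sum_(x <- S) \sum_(y <- S) (K x y - K' x y) * xi y * eta x))).
  by rewrite -mulrDr ler_wpM2l// le_normcD.
rewrite addrC lerD//.
apply: (@le_trans _ _ (e / W * (W - 1))); last first.
  by rewrite mulrAC ler_pdivrMr// ler_wpM2l ?(ltW e0)//; lra.
rewrite /W addrK mulrCA ler_wpM2l//.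
apply: le_trans (le_normc_sum _ _ _) _; rewrite mulr_sumr; apply: ler_sum => x _.
apply: le_trans (le_normc_sum _ _ _) _; rewrite mulr_sumr; apply: ler_sum => y _.
by rewrite !normcM -mulrA ler_wpM2r ?mulr_ge0 ?normc_ge0.
Qed.

(** On delta functions the two inner products are entries of the kernels; both
    sides are sesquilinear and continuous, so the deltas suffice. *)
Lemma is_adjoint_kernel u v : is_adjoint u v <->
  (forall x y, opker v x y = (opker u y x)^*%C).
Proof.
split=> h.
  move=> x y; have := h (delta x) (delta y).
  by rewrite inner_deltar inner_deltal /opker => ->; rewrite conjcK.
pose D xi eta := inner (u xi) eta - inner xi (v eta).
suff D0 : forall a b, D a b = 0 by move=> xi eta; apply/eqP; rewrite -subr_eq0; apply/eqP/D0.
have DC (a b : C) xi eta : D (a *: xi) (b *: eta) = a * b^*%C * D xi eta.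
  by rewrite /D !linearZZ !innerZl !innerZr; ring.
have DDl xi xi' eta : D (xi + xi') eta = D xi eta + D xi' eta.
  by rewrite /D linearD !innerDl; ring.
have DDr xi eta eta' : D xi (eta + eta') = D xi eta + D xi eta'.
  by rewrite /D linearD !innerDr; ring.
have Db : exists2 N : R, 0 <= N &
    forall xi eta, normc (D xi eta) <= N * l2norm xi * l2norm eta.
  exists (nrm u + nrm v) => [|x e]; first by rewrite addr_ge0 ?nrm_ge0.
  apply: le_trans (normcB _ _) _; rewrite !mulrDl; apply: lerD.
    apply: le_trans (inner_CS _ _) _.
    by rewrite ler_wpM2r ?l2norm_ge0 ?nrmP.
  apply: le_trans (inner_CS _ _) _.
  by rewrite mulrAC mulrC ler_wpM2r ?l2norm_ge0 ?nrmP// mulrC nrmP.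
have [N N0 hN] := Db.
have dd x y : D (delta x) (delta y) = 0.
  rewrite /D inner_deltar inner_deltal; apply/eqP; rewrite subr_eq0; apply/eqP.
  by have := h x y; rewrite /opker => ->; rewrite conjcK.
have d1 x (zeta : H) : D (delta x) zeta = 0.
  rewrite -[LHS]conjcK; apply/eqP; rewrite conjc_eq0; apply/eqP.
  apply: (@vanish_on_deltas _ _ (fun z => (D (delta x) z)^*%C)).
  - by move=> a b; rewrite DDr rmorphD.
  - move=> c y; rewrite -{1}(scale1r (delta x)) DC dd mulr0; exact: conjc0.
  - by exists (N * l2norm (delta x : H)) => z; rewrite normc_conj.
move=> xi eta; apply: (@vanish_on_deltas _ _ (D^~ eta)).
- by move=> a b; rewrite DDl.
- by move=> c x; rewrite -(scale1r eta) DC d1 mulr0.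
- by exists (N * l2norm eta) => z; rewrite mulrAC.
Qed.

Lemma is_adjoint_uniq u v v' : is_adjoint u v -> is_adjoint u v' -> v = v'.
Proof.
move=> /is_adjoint_kernel h /is_adjoint_kernel h'.
by apply: opker_inj => x y; rewrite h h'.
Qed.

Lemma nrm_adjoint u v : is_adjoint u v -> nrm v = nrm u.
Proof.
have le_adj (a b : bop R G) : is_adjoint a b -> nrm b <= nrm a.
  move=> /is_adjoint_kernel h; apply/nrm_kbound; first exact: nrm_ge0.
  by apply: kbound_ext (kbound_adj (kbound_nrm a)) => x y; rewrite h.
move=> uv; apply/eqP; rewrite eq_le le_adj//= le_adj//.
move/is_adjoint_kernel: uv => h; apply/is_adjoint_kernel => x y.
by rewrite h conjcK.
Qed.

Lemma exists_adjoint u : exists v, is_adjoint u v.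
Proof.
have [v hv] := kernel_bop (nrm_ge0 u) (kbound_adj (kbound_nrm u)).
by exists v; apply/is_adjoint_kernel.
Qed.

Lemma real_geometric_lim (a : nat -> R) (M : R) : 0 <= M ->
  (forall n, `|a n.+1 - a n| <= M / 2 ^+ n) ->
  exists l : R, forall n, `|l - a n| <= 2 * M / 2 ^+ n.
Proof.
move=> M0 h.
(* The intervals [a n - d n, a n + d n] are nested. *)
pose d n : R := 2 * M / 2 ^+ n.
have dS n : d n = M / 2 ^+ n + d n.+1.
  rewrite /d exprS; field; by rewrite expf_neq0.
have incr n j : a n - d n <= a (n + j)%N - d (n + j)%N.
  elim: j => [|j]; first by rewrite addn0.
  move=> /le_trans; apply; rewrite addnS [d (n + j)%N]dS.
  by have := h (n + j)%N; rewrite ler_norml; lra.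
have decr n j : a (n + j)%N + d (n + j)%N <= a n + d n.
  elim: j => [|j]; first by rewrite addn0.
  apply: le_trans; rewrite addnS [d (n + j)%N]dS.
  by have := h (n + j)%N; rewrite ler_norml; lra.
have d0 n : 0 <= d n by rewrite /d divr_ge0 ?mulr_ge0 ?exprn_ge0.
have cross m n : a m - d m <= a n + d n.
  apply: le_trans (incr m n) _; rewrite addnC; apply: le_trans (decr n m).
  by have := d0 (n + m)%N; lra.
pose E := range (fun n => a n - d n).
have E0 : (E !=set0)%classic by exists (a 0%N - d 0%N); exists 0%N.
have Eub n : ubound E (a n + d n) by move=> _ [m _ <-]; exact: cross.
have Esup : has_sup E by split=> //; exists (a 0%N + d 0%N); exact: Eub.
exists (sup E) => n; rewrite ler_norml -/(d n).
have : a n - d n <= sup E by apply: (sup_upper_bound Esup); exists n.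
have : sup E <= a n + d n by apply: ge_sup.
lra.
Qed.

Lemma complex_geometric_lim (a : nat -> C) (M : R) : 0 <= M ->
  (forall n, normc (a n.+1 - a n) <= M / 2 ^+ n) ->
  exists l : C, forall n, normc (l - a n) <= 4 * M / 2 ^+ n.
Proof.
move=> M0 h.
have [n|lr hr] := @real_geometric_lim (fun n => complex.Re (a n)) M M0.
  by rewrite -raddfB; apply: le_trans (normc_Re _) (h n).
have [n|li hi] := @real_geometric_lim (fun n => complex.Im (a n)) M M0.
  by rewrite -raddfB; apply: le_trans (normc_Im _) (h n).
exists (lr +i* li)%C => n; apply: le_trans (normc_ReIm _) _.
have := hr n; have := hi n; rewrite !raddfB /= -!mulrA.
lra.
Qed.

(** The entries of the kernels converge, and the limit kernel inherits the bounds
    of u m - u n by [kbound_approx]. *)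
Lemma bop_complete (u : nat -> bop R G) (M : R) : 0 <= M ->
  (forall n, nrm (u n.+1 - u n) <= M / 2 ^+ n) ->
  exists v : bop R G, forall n, nrm (v - u n) <= 2 * M / 2 ^+ n.
Proof.
move=> M0 h.
have tele n j : nrm (u (n + j)%N - u n) <= 2 * M / 2 ^+ n.
  suff : nrm (u (n + j)%N - u n) <= 2 * M / 2 ^+ n - 2 * M / 2 ^+ (n + j).
    by move=> /le_trans; apply; rewrite gerBl divr_ge0 ?mulr_ge0 ?exprn_ge0.
  elim: j => [|j IH]; first by rewrite addn0 !subrr nrm0.
  rewrite addnS; rewrite -[X in nrm X](subrKA (u (n + j)%N)).
  apply: le_trans (nrmD _ _) _; apply: le_trans (lerD (h _) IH) _.
  rewrite exprS; set q := 2 ^+ (n + j) : R.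
  have q0 : q != 0 by rewrite expf_neq0.
  rewrite (_ : M / q = 2 * M / q - 2 * M / (2 * q)); last by field.
  lra.
have [k hk] : exists k : G -> G -> C, forall x y n,
    normc (k x y - opker (u n) x y) <= 4 * M / 2 ^+ n.
  have ex x y : exists l : C, forall n, normc (l - opker (u n) x y) <= 4 * M / 2 ^+ n.
    apply: complex_geometric_lim => // n; rewrite -opkerB.
    apply: kbound_entry; apply/nrm_kbound => //.
    by rewrite divr_ge0 ?exprn_ge0.
  exists (fun x y => projT1 (cid (ex x y))) => x y n.
  by case: cid.
have small (e : R) n : 0 < e -> exists j, 4 * M / 2 ^+ (n + j) <= e.
  move=> e0; have c0 : 0 <= 4 * M / 2 ^+ n by rewrite divr_ge0 ?exprn_ge0 ?mulr_ge0.
  have [j hj] := exists_geometric_le c0 e0; exists j.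
  by rewrite exprD invfM mulrA.
have kb n : kbound (fun x y => k x y - opker (u n) x y) (2 * M / 2 ^+ n).
  apply: kbound_approx => e e0; have [j hj] := small e n e0.
  exists (opker (u (n + j)%N - u n)).
    apply/nrm_kbound => //.
    by rewrite divr_ge0 ?exprn_ge0 ?mulr_ge0.
  move=> x y; rewrite opkerB opprB addrA subrK.
  by apply: le_trans (hk _ _ _) hj.
have M20 n : 0 <= 2 * M / 2 ^+ n by rewrite divr_ge0 ?exprn_ge0 ?mulr_ge0.
have kB : kbound k (2 * M / 2 ^+ 0 + nrm (u 0)).
  have := kboundD (kb 0) (kbound_nrm (u 0)); apply: kbound_ext => x y.
  by rewrite subrK.
have [v hv] := kernel_bop (addr_ge0 (M20 0) (nrm_ge0 (u 0))) kB.
exists v => n; apply/nrm_kbound => //.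
by apply: kbound_ext (kb n) => x y; rewrite opkerB hv.
Qed.

End KernelOperators.

(** * The reduced group algebra: involution and completeness *)

Section CstarTheory.
Context {R : realType} {G : groupType}.
Local Notation C := R[i].
Local Notation H := (l2 R G).
Local Notation c_c := (@fin_supp_fun R G).
Implicit Types (f g : c_c) (a b : Cstar R G) (u v : bop R G).

Lemma opker_lambda f x y : opker (lambda f) x y = f (x * y^-1)%g.
Proof.
rewrite (lambdaE (@fsfun_dflt _ _ _ f)) /opker bop_sumE.
transitivity (trunc (finsupp f) f (x * y^-1)%g); last first.
  by rewrite truncE; case: finsuppP.
rewrite /trunc l2_sumE; apply: eq_bigr => a _; congr (_ * (nat_of_bool _)%:R).
apply/eqP/eqP => [<-|<-]; first by rewrite invgM invgK mulgA mulgV mul1g.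
by rewrite invgM invgK -mulgA mulVg mulg1.
Qed.

Definition conj_inv f : c_c :=
  [fsfun x in [fset y^-1%g | y in finsupp f]%fset => ((f x^-1%g)^*)%C].

Lemma conj_invE f x : conj_inv f x = (f x^-1%g)^*%C.
Proof.
rewrite fsfunE; case: ifPn => // /imfsetP h; rewrite fsfun_dflt ?conjc0//.
apply/negP => xf; apply: h; exists x^-1%g => //=; by rewrite invgK.
Qed.

Lemma lambda_adjoint f : is_adjoint (lambda f) (lambda (conj_inv f)).
Proof.
by apply/is_adjoint_kernel => x y; rewrite !opker_lambda conj_invE invgM invgK.
Qed.

Lemma cstar_red_nrmP u : u \in @cstar_red R G <->
  (forall e : R, 0 < e -> exists f, nrm (u - lambda f) <= e).
Proof.
split=> [/asboolP h e /h[f]|h]; first by rewrite nrmE lee_fin; exists f.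
by apply/asboolP => e /h[f hf]; exists f; rewrite nrmE lee_fin.
Qed.

Lemma cstar_red_adjoint u v : is_adjoint u v -> u \in @cstar_red R G ->
  v \in @cstar_red R G.
Proof.
move=> uv /cstar_red_nrmP hu; apply/cstar_red_nrmP => e /hu[f hf].
exists (conj_inv f); rewrite (@nrm_adjoint _ _ (u - lambda f))//.
apply/is_adjoint_kernel => x y; rewrite !opkerB rmorphB.
by rewrite (proj1 (is_adjoint_kernel _ _) uv)
  (proj1 (is_adjoint_kernel _ _) (lambda_adjoint f)).
Qed.

(** The adjoint is unique, so the choice made in [star] is determined. *)
Lemma star_eq a b : is_adjoint a b -> star a = b.
Proof.
move=> ab; apply: xget_unique => // c ac; apply: val_inj.
exact: is_adjoint_uniq ac ab.
Qed.

(** The adjoint of a limit of lambda f is the limit of the lambda f^*, so it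
    stays in the algebra. *)
Lemma star_adjoint a : is_adjoint a (star a).
Proof.
have [v av] := exists_adjoint a.
have := cstar_red_adjoint av (CstarP a) => vP.
by rewrite (@star_eq a (CstarElt vP)).
Qed.

Lemma star_lambda f : star (lambda_cstar f) = lambda_cstar (conj_inv f).
Proof. by apply: star_eq; exact: lambda_adjoint. Qed.

Lemma nrm_star a : nrm (star a) = nrm a.
Proof. exact: nrm_adjoint (star_adjoint a). Qed.

Lemma is_adjoint_sym u v : is_adjoint u v -> is_adjoint v u.
Proof.
move=> /is_adjoint_kernel h; apply/is_adjoint_kernel => x y.
by rewrite h conjcK.
Qed.

Lemma is_adjointD u u' v v' : is_adjoint u v -> is_adjoint u' v' ->
  is_adjoint (u + u') (v + v').
Proof.
move=> /is_adjoint_kernel h /is_adjoint_kernel h'; apply/is_adjoint_kernel => x y.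
by rewrite !opkerD rmorphD h h'.
Qed.

Lemma is_adjointZ (c : C) u v : is_adjoint u v -> is_adjoint (c *: u) (c^*%C *: v).
Proof.
move=> /is_adjoint_kernel h; apply/is_adjoint_kernel => x y.
by rewrite !opkerZ rmorphM h.
Qed.

Lemma is_adjointM u u' v v' : is_adjoint u v -> is_adjoint u' v' ->
  is_adjoint (u * u') (v' * v).
Proof. by move=> h h' xi eta; rewrite [LHS]h h'. Qed.

Lemma is_adjoint1 : is_adjoint (1 : bop R G) 1.
Proof. by []. Qed.

Lemma is_adjoint0 : is_adjoint (0 : bop R G) 0.
Proof. by have := is_adjointZ 0 is_adjoint1; rewrite conjc0 !scale0r. Qed.

Lemma is_adjoint_lim u : (forall e : R, 0 < e ->
    exists2 v, is_adjoint v v & nrm (u - v) <= e) -> is_adjoint u u.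
Proof.
move=> h; apply/is_adjoint_kernel => x y; apply/eqP; rewrite -subr_eq0; apply/eqP.
apply: normc_small => e e0; have e2 : 0 < e / 2 by rewrite divr_gt0.
have [v hv huv] := h (e / 2) e2.
have kv := proj1 (is_adjoint_kernel _ _) hv.
have small x' y' : normc (opker u x' y' - opker v x' y') <= e / 2.
  rewrite -opkerB; apply: kbound_entry; apply/nrm_kbound => //.
  by rewrite divr_ge0// ltW.
have -> : opker u x y - (opker u y x)^*%C =
    (opker u x y - opker v x y) - (opker u y x - opker v y x)^*%C.
  by rewrite rmorphB [opker v x y]kv opprB addrA subrK.
apply: le_trans (normcB _ _) _; rewrite normc_conj [leRHS]splitr.
by rewrite lerD.
Qed.

Lemma Cstar_complete (u : nat -> Cstar R G) (M : R) : 0 <= M ->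
  (forall n, nrm (u n.+1 - u n) <= M / 2 ^+ n) ->
  exists v : Cstar R G, forall n, nrm (v - u n) <= 2 * M / 2 ^+ n.
Proof.
move=> M0 h; have [v hv] := bop_complete M0 h.
suff vP : v \in @cstar_red R G by exists (CstarElt vP).
apply/cstar_red_nrmP => e e0; have e2 : 0 < e / 2 by rewrite divr_gt0.
have [n hn] := exists_geometric_le (mulr_ge0 (ler0n _ 2) M0) e2.
have [f hf] := proj1 (cstar_red_nrmP _) (CstarP (u n)) _ e2.
exists f; rewrite -[v](subrK (u n : bop R G)) -addrA.
apply: le_trans (nrmD _ _) _; rewrite [leRHS]splitr lerD//.
exact: le_trans (hv n) hn.
Qed.

End CstarTheory.

(** * States are uniformly bounded *)

Section States.
Context {R : realType} {G : groupType}.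
Local Notation C := R[i].
Local Notation A := (Cstar R G).
Implicit Types (a b h : A) (mu : state (@star R G)).

(** The source of positive elements: 1 - h is a square of a self-adjoint
    element of the algebra itself, by completeness. *)
Lemma sqrt_one_minus h : is_adjoint h h -> nrm h <= 4^-1 ->
  exists c : A, is_adjoint c c /\ c * c = 1 - h.
Proof.
move=> hh h4; pose half : C := (2^-1 : R)%:C%C.
have nhalf : normc half = 2^-1 by rewrite normc_real ger0_norm ?invr_ge0.
have halfC : half^*%C = half by rewrite /half conjc_real.
(* With y = (h + y^2) / 2 one has (1 - y)^2 = 1 - h. The map preserves the
   self-adjoint elements of norm <= 1/4 and contracts them by 1/4. *)
pose y := fix y n : A := if n is n.+1 then half *: (h + y n * y n) else 0.
have yS n : y n.+1 = half *: (h + y n * y n) by [].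
have yA n : is_adjoint (y n) (y n).
  elim: n => [|n IH]; first exact: is_adjoint0.
  have := is_adjointZ half (is_adjointD hh (is_adjointM IH IH)).
  by rewrite halfC.
have y4 n : nrm (y n) <= 4^-1.
  elim: n => [|n IH]; first by rewrite nrm0 invr_ge0.
  rewrite [nrm _]nrmZ nhalf; have := nrmD h (y n * y n : A).
  have := nrmM (y n) (y n); have := nrm_ge0 (y n).
  by nra.
have yD n : nrm (y n.+1 - y n : A) <= 1 / 2 ^+ n.
  elim: n => [|n IH].
    rewrite [y 1%N]yS [nrm _](_ : _ = nrm (half *: (h : bop R G))).
      by rewrite nrmZ nhalf expr0 divr1; have := nrm_ge0 h; lra.
    by congr nrm; rewrite /= mulr0 addr0 subr0.
  pose a := y n.+1; pose b := y n.
  have -> : y n.+2 - y n.+1 = half *: (a * (a - b) + (a - b) * b).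
    rewrite [y n.+2]yS [in X in _ - X]yS -scalerBr -/a -/b; congr (_ *: _).
    by rewrite opprD addrACA subrr add0r mulrBr mulrBl addrA subrK.
  rewrite [nrm _]nrmZ nhalf.
  have h1 := nrmD (a * (a - b)) ((a - b) * b).
  have h2 := nrmM a (a - b); have h3 := nrmM (a - b) b.
  have a4 : nrm a <= 4^-1 := y4 n.+1; have b4 : nrm b <= 4^-1 := y4 n.
  have d0 := nrm_ge0 (a - b).
  apply: (@le_trans _ _ (2^-1 * nrm (a - b))).
    rewrite ler_wpM2l ?invr_ge0//; apply: le_trans h1 _.
    have k2 : nrm (a * (a - b)) <= 4^-1 * nrm (a - b).
      by apply: le_trans h2 _; rewrite ler_wpM2r.
    have k3 : nrm ((a - b) * b) <= nrm (a - b) * 4^-1.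
      by apply: le_trans h3 _; rewrite ler_wpM2l.
    lra.
  by rewrite exprS invfM mulrCA ler_wpM2l ?invr_ge0.
have [v hv] := Cstar_complete ler01 yD.
have small (e : R) : 0 < e -> exists n, nrm (v - y n) <= e.
  move=> e0; have [n hn] := exists_geometric_le (mulr_ge0 (ler0n R 2) ler01) e0.
  by exists n; apply: le_trans (hv n) hn.
have vA : is_adjoint v v.
  by apply: is_adjoint_lim => e /small[n hn]; exists (y n).
pose w := half *: (h + v * v) - v.
have w0 : w = 0.
  apply: val_inj; apply: nrm0_eq0; apply/ler_addgt0Pl => e e0; rewrite addr0.
  have e4 : 0 < e / 4 by rewrite divr_gt0.
  have [n hn] := exists_geometric_le (mulr_ge0 (ler0n R 2) ler01) e4.
  pose z := y n; pose z' := y n.+1.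
  have d1 : nrm (v - z) <= e / 4 by apply: le_trans (hv n) hn.
  have d2 : nrm (z' - v) <= e / 4.
    rewrite nrm_distC; apply: le_trans (hv n.+1) (le_trans _ hn).
    by rewrite ler_wpM2l ?mulr_ge0// lef_pV2 ?posrE ?exprn_gt0// ler_weXn2l// ler1n.
  have v2 : nrm v <= 2.
    by have := hv 0%N; rewrite expr0 divr1 mulr1 [nrm _](_ : _ = nrm v)//= subr0.
  have wE : w = half *: (v * (v - z) + (v - z) * z) + (z' - v).
    have -> : v * (v - z) + (v - z) * z = v * v - z * z.
      by rewrite mulrBr mulrBl addrA subrK.
    by rewrite /w /z' yS -/z addrA -scalerDr [in RHS]addrCA subrK.
  have z4 : nrm z <= 4^-1 := y4 n.
  have d0 := nrm_ge0 (v - z).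
  rewrite [nrm _](_ : _ = nrm (half *: (v * (v - z) + (v - z) * z) + (z' - v))).
    apply: le_trans (nrmD _ _) _; rewrite nrmZ nhalf.
    have := nrmD (v * (v - z)) ((v - z) * z).
    have k2 : nrm (v * (v - z)) <= 2 * nrm (v - z).
      by apply: le_trans (nrmM _ _) _; rewrite ler_wpM2r.
    have k3 : nrm ((v - z) * z) <= nrm (v - z) * 4^-1.
      by apply: le_trans (nrmM _ _) _; rewrite ler_wpM2l.
    lra.
  by rewrite wE.
exists (1 - v); split.
  rewrite /= -scaleN1r.
  have := is_adjointD (@is_adjoint1 R G) (is_adjointZ (-1) vA).
  by rewrite rmorphN1.
have half2 : half + half = 1 by rewrite /half -rmorphD /= (_ : 2^-1 + 2^-1 = 1 :> R)//; lra.
have vv : v + v = h + v * v.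
  have wE : half *: (h + v * v) = v by apply/eqP; rewrite -subr_eq0 -/w w0.
  by rewrite -[in LHS]wE -scalerDl half2 scale1r.
have -> : h = v + v - v * v by rewrite vv addrK.
by rewrite mulrBr mulr1 mulrBl mul1r -[in RHS]addrA [in RHS]opprD [in RHS]addrA.
Qed.

Lemma stateB mu a b : mu (a - b) = mu a - mu b.
Proof. by rewrite [a - b]addrC -scaleN1r state_linear mulN1r addrC. Qed.

Lemma stateD mu a b : mu (a + b) = mu a + mu b.
Proof. by have := state_linear mu 1 a b; rewrite scale1r mul1r. Qed.

Lemma stateZ mu (c : C) a : mu (c *: a) = c * mu a.
Proof.
have m0 : mu 0 = 0 by rewrite -(subrr 1) stateB subrr.
by have := state_linear mu c a 0; rewrite addr0 m0 addr0.
Qed.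

Lemma state_sum mu I (s : seq I) (F : I -> A) :
  mu (\sum_(i <- s) F i) = \sum_(i <- s) mu (F i).
Proof.
elim: s => [|i s IH]; last by rewrite !big_cons stateD IH.
by rewrite !big_nil -(subrr 1) stateB subrr.
Qed.

(** Both 1 - h and 1 + h are of the form c^* c, so a state maps h into
    [-1, 1]. *)
Lemma state_selfadjoint_small mu h : is_adjoint h h -> nrm h <= 4^-1 ->
  normc (mu h) <= 1.
Proof.
have pos (k : A) : is_adjoint k k -> nrm k <= 4^-1 -> 0 <= 1 - mu k.
  move=> kk k4; have [c [cc ck]] := sqrt_one_minus kk k4.
  by have := state_positive mu c; rewrite (star_eq cc) ck stateB state_unital.
move=> hh h4; have h1 := pos h hh h4.
have hN : is_adjoint (- h) (- h).
  have := is_adjointZ (-1) hh.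
  by rewrite rmorphN1 -[(-1 *: \val h)]/(\val (-1 *: h)) scaleN1r.
have := pos _ hN; rewrite -[nrm _]/(nrm (- (h : bop R G))) nrmN => /(_ h4).
rewrite -[- h]scaleN1r stateZ mulN1r opprK; move: h1.
case: (mu h) => p q; rewrite !lecE /= => /andP[/eqP q0 p1] /andP[_ p2].
have {q0} -> : q = 0 by move: q0; lra.
by rewrite expr0n addr0 sqrtr_sqr ler_norml; apply/andP; split; lra.
Qed.

Lemma state_selfadjoint_bounded mu h : is_adjoint h h ->
  normc (mu h) <= 4 * nrm h.
Proof.
move=> hh; apply/ler_addgt0Pl => e e0.
pose t := 4 * nrm h + e; have t0 : 0 < t by rewrite ltr_wpDl ?mulr_ge0 ?nrm_ge0.
have nt : normc t^-1%:C%C = t^-1 by rewrite normc_real ger0_norm// invr_ge0 ltW.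
have := @state_selfadjoint_small mu (t^-1%:C%C *: h).
rewrite stateZ normcM nt addrC -/t => H.
rewrite -(@ler_pM2l _ t^-1) ?invr_gt0// mulVf ?gt_eqF//; apply: H.
  by have := is_adjointZ t^-1%:C%C hh; rewrite conjc_real.
rewrite [nrm _]nrmZ nt ler_pdivrMl// /t; lra.
Qed.

(** The best constant is 1; any constant serves for the comparison of the two
    topologies. *)
Lemma state_bounded mu a : normc (mu a) <= 8 * nrm a.
Proof.
(* 2 a = h1 - i h2 with h1 and h2 self-adjoint. *)
pose h1 := a + star a; pose h2 := 'i%C *: a - 'i%C *: star a.
have sa := star_adjoint a; have as_ := is_adjoint_sym sa.
have ci : ('i%C : C)^*%C = - 'i%C by apply/eqP; rewrite eq_complex /= oppr0 !eqxx.
have ciN : (- 'i%C : C)^*%C = 'i%C by rewrite -[in LHS]ci conjcK.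
have s1 : is_adjoint h1 h1.
  by have := is_adjointD sa as_; rewrite [X in is_adjoint _ X]addrC.
have s2 : is_adjoint h2 h2.
  have := is_adjointD (is_adjointZ 'i%C sa) (is_adjointZ (- 'i%C) as_).
  by rewrite ci ciN !scaleNr [X in is_adjoint _ X]addrC.
have n1 : normc ('i%C : C) = 1 by rewrite /= expr0n expr1n add0r sqrtr1.
have b1 : nrm h1 <= 2 * nrm a by have := nrmD a (star a); rewrite nrm_star; lra.
have b2 : nrm h2 <= 2 * nrm a.
  have := nrmB ('i%C *: (a : bop R G)) ('i%C *: (star a : bop R G)).
  by rewrite !nrmZ nrm_star n1; lra.
have ii : 'i%C * 'i%C = -1 :> C.
  apply/eqP; rewrite eq_complex /=.
  by rewrite !(mulr0, mul0r, mulr1, addr0, sub0r) oppr0 !eqxx.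
have E : 2 * mu a = mu h1 - 'i%C * mu h2.
  rewrite /h1 /h2 stateD stateB !stateZ mulrBr !mulrA ii; ring.
have n2 : normc (2 : C) = 2.
  by rewrite -[2 in LHS](rmorph_nat (real_complex R) 2) normc_real ger0_norm.
have := state_selfadjoint_bounded mu s1; have := state_selfadjoint_bounded mu s2.
have : 2 * normc (mu a) = normc (mu h1 - 'i%C * mu h2) by rewrite -E normcM n2.
by have := normcB (mu h1) ('i%C * mu h2); rewrite normcM n1; lra.
Qed.

End States.

(** * The commutator with the length function *)

Section Dirac.
Context {R : realType} {G : groupType}.
Local Notation C := R[i].
Local Notation H := (l2 R G).
Local Notation c_c := (@fin_supp_fun R G).
Implicit Types (f g : c_c) (u v : bop R G) (M : R).
Variables (l : G -> R).

Definition lambda_kernel (F : G -> C) (x y : G) : C := F (x * y^-1)%g.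

Definition dirac_kernel (F : G -> C) (x y : G) : C :=
  (l x - l y)%:C%C * F (x * y^-1)%g.

(** Rows with finite support are evaluated by a finite sum: both sides are
    continuous and linear in xi, and agree on delta functions. *)
Lemma row_eval u x (S : {fset G}) : (forall y, y \notin S -> opker u x y = 0) ->
  forall xi : H, u xi x = \sum_(y <- S) opker u x y * xi y.
Proof.
move=> uS xi; apply/eqP; rewrite -subr_eq0; apply/eqP.
pose F (z : H) : C := u z x - \sum_(y <- S) opker u x y * z y.
rewrite -[LHS]/(F xi); apply: vanish_on_deltas.
- move=> a b; rewrite /F linearD.
  under eq_bigr do rewrite l2_addE mulrDr.
  have -> : (u a + u b) x = u a x + u b x by [].
  by rewrite big_split/= opprD addrACA.
- move=> c z; rewrite /F linearZZ.
  have -> : (c *: u (delta z)) x = c * opker u x z by [].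
  rewrite (_ : \sum_(y <- S) _ = c * trunc S (opker u x) z); last first.
    rewrite /trunc l2_sumE mulr_sumr; apply: eq_bigr => y _.
    have -> : (c *: delta z : H) y = c * (y == z)%:R by [].
    have -> : (opker u x y *: delta y : H) z = opker u x y * (z == y)%:R by [].
    by rewrite eq_sym; ring.
  by rewrite truncE; case: ifPn => [|/uS ->]; rewrite subrr.
- exists (nrm u + \sum_(y <- S) normc (opker u x y)) => z.
  apply: le_trans (normcB _ _) _; rewrite mulrDl; apply: lerD.
    by apply: le_trans (normc_le_l2norm _ _) (nrmP _ _).
  apply: le_trans (le_normc_sum _ _ _) _; rewrite mulr_suml; apply: ler_sum => y _.
  by rewrite normcM ler_wpM2l ?normc_ge0 ?normc_le_l2norm.
Qed.

Hypothesis l_length : length_function l.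

Lemma len_ge0 x : 0 <= l x. Proof. by case: l_length. Qed.
Lemma lenM x y : l (x * y)%g <= l x + l y. Proof. by case: l_length. Qed.
Lemma lenV x : l x^-1%g = l x. Proof. by case: l_length. Qed.
Lemma len_eq0 x : l x = 0 <-> x = 1%g. Proof. by case: l_length. Qed.
Lemma len1 : l 1%g = 0. Proof. exact/len_eq0. Qed.

Lemma len_quotient x y : l (x * y^-1)%g <= l x + l y.
Proof. by rewrite -(lenV y) lenM. Qed.

Lemma len_dist a x : `|l x - l (a^-1 * x)%g| <= l a.
Proof.
have h1 := lenM a^-1 x; have h2 := lenM a (a^-1 * x).
rewrite mulVKg in h2; rewrite lenV in h1; rewrite ler_norml.
by apply/andP; split; lra.
Qed.

Lemma dirac_operator f : exists s : bop R G,
  forall x y, opker s x y = dirac_kernel f x y.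
Proof.
suff [M bM] : exists M, kbound (dirac_kernel f) M.
  exact: kernel_bop (kbound_ge0 1%g bM) bM.
(* The kernel is the sum over a of f a (l x - l (a^-1 x)) transl a, and the
   diagonal weight is bounded by l a. *)
pose c a x : C := ((l x - l (a^-1 * x)%g) / (l a + 1))%:C%C.
have la1 a : 0 < l a + 1 by rewrite ltr_wpDl ?len_ge0.
have c1 a x : normc (c a x) <= 1.
  rewrite normc_real normrM normfV (gtr0_norm (la1 a)) ler_pdivrMr// mul1r.
  by apply: le_trans (len_dist a x) _; rewrite lerDl.
pose one (y : G) : C := 1.
have one1 y : normc (one y) <= 1 by rewrite normc1.
have b a := kboundZ (f a * (l a + 1)%:C%C)
  (kbound_weight (nrm_ge0 (transl R a)) (c1 a) one1 (kbound_nrm (transl R a))).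
eexists; apply: kbound_ext (kbound_sum (enum_fset (finsupp f)) b) => x y.
rewrite /dirac_kernel -opker_lambda (lambdaE (@fsfun_dflt _ _ _ f)).
rewrite {2}/opker bop_sumE mulr_sumr; apply: eq_bigr => a _.
rewrite /opker /one mulr1 /= /c.
have [<-|_] := eqVneq (a^-1 * x)%g y; last by rewrite !(mulr0, mul0r).
set d := l x - _.
have E : (l a + 1)%:C%C * (d / (l a + 1))%:C%C = d%:C%C.
  by rewrite -rmorphM mulrC divfK ?gt_eqF.
by rewrite -[d%:C%C in RHS]E /=; ring.
Qed.

(** The domain of the commutator contains the delta functions, which determine a
    bounded operator, so s is its only bounded extension. That s does extend it
    on the whole domain is a computation on rows, which are finitely supported. *)
Lemma dirac_seminormE f (s : bop R G) :
  (forall x y, opker s x y = dirac_kernel f x y) ->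
  dirac_seminorm l (lambda_cstar f) = opnorm s.
Proof.
move=> hs; rewrite /dirac_seminorm.
set E := (X in ereal_inf X).
suff -> : E = [set opnorm s]%classic by rewrite ereal_inf1.
rewrite /E; apply/seteqP; split=> e /=.
  move=> [s' hs' <-]; congr opnorm; apply: opker_inj => x y.
  rewrite /opker; congr (l2_fun _ x).
  set d := delta y.
  (* delta y lies in the domain of the commutator; l * u (delta y) is recovered
     from s as s (delta y) + u (l * delta y). *)
  pose eta1 : H := (l y)%:C%C *: d.
  apply: hs'; exists eta1, (s d + lambda f eta1); split.
  - move=> z; rewrite -[LHS]/((l y)%:C%C * (z == y)%:R) /=.
    by case: eqVneq => [->|] //; rewrite !mulr0.
  - move=> z; rewrite l2_addE /eta1 linearZZ.
    rewrite -[X in X + _]/(opker s z y) hs -[X in _ + X]/((l y)%:C%C * opker (lambda f) z y).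
    rewrite -[RHS]/((l z)%:C%C * opker (lambda f) z y) opker_lambda /dirac_kernel.
    by rewrite rmorphB -mulrDl subrK.
  - by rewrite addrK.
move=> ->; exists s => // xi zeta [eta1 [eta2 [h1 h2 ->]]].
apply: l2_inj => x; rewrite l2_subE h2.
pose S := [fset (a^-1 * x)%g | a in finsupp f]%fset.
have fS y : y \notin S -> f (x * y^-1)%g = 0.
  move=> yS; apply: fsfun_dflt; apply: contra yS => xy.
  by apply/imfsetP; exists (x * y^-1)%g => //; rewrite invgM invgK -mulgA mulVg mulg1.
rewrite (@row_eval s x S) => [|y yS]; last by rewrite hs /dirac_kernel fS ?mulr0.
rewrite !(@row_eval (lambda f) x S) => [|y yS|y yS]; rewrite ?opker_lambda ?fS//.
rewrite mulr_sumr -sumrB; apply: eq_bigr => y _.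
rewrite hs opker_lambda h1 /dirac_kernel rmorphB; ring.
Qed.

Lemma dirac_seminorm_leP f M : 0 <= M ->
  (dirac_seminorm l (lambda_cstar f) <= M%:E)%E <-> kbound (dirac_kernel f) M.
Proof.
move=> M0; have [s hs] := dirac_operator f.
rewrite (dirac_seminormE hs) (opnorm_kbound _ M0).
by split; apply: kbound_ext => x y; rewrite hs.
Qed.

(** * Doubling, cutoffs and the tail estimate *)

Hypothesis l_proper : proper_length l.
Variable D : R.
Hypothesis D_doubling : forall r, 1 <= r ->
    #|` fset_set (length_ball l (2 * r))|%:R <=
      D * #|` fset_set (length_ball l r)|%:R :> R.

Definition lball r : {fset G} := fset_set (length_ball l r).

Lemma in_lball r x : (x \in lball r) = (l x <= r).
Proof.
rewrite in_fset_set; last exact: l_proper.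
by apply/idP/idP => [/set_mem|h]; last exact: mem_set.
Qed.

Definition vol r : R := #|` lball r|%:R.

Lemma vol_mono r r' : r <= r' -> vol r <= vol r'.
Proof.
move=> rr'; rewrite ler_nat; apply: fsubset_leq_card; apply/fsubsetP => x.
by rewrite !in_lball => /le_trans; apply.
Qed.

Lemma vol_gt0 r : 0 <= r -> 0 < vol r.
Proof.
move=> r0; rewrite ltr0n cardfs_gt0; apply/fset0Pn; exists 1%g.
by rewrite in_lball len1.
Qed.

Lemma doubling_ge1 : 1 <= D.
Proof.
have v1 := vol_gt0 ler01; rewrite -(@ler_pM2r _ (vol 1))// mul1r.
by apply: le_trans (D_doubling (lexx 1)); apply: vol_mono; rewrite mulr1 ler1n.
Qed.

Lemma doubling_ge0 : 0 <= D.
Proof. exact: le_trans ler01 doubling_ge1. Qed.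

Lemma le_pow2M n (r : R) : 0 <= r -> r <= 2 ^+ n * r.
Proof. by move=> r0; rewrite ler_peMl// exprn_ege1// ler1n. Qed.

Lemma vol_doubling_iter n r : 1 <= r -> vol (2 ^+ n * r) <= D ^+ n * vol r.
Proof.
move=> r1; elim: n => [|n IH]; first by rewrite !expr0 !mul1r.
have r1' : 1 <= 2 ^+ n * r.
  exact: le_trans (r1) (le_pow2M n (le_trans ler01 r1)).
rewrite exprS -mulrA; apply: le_trans (D_doubling r1') _.
by rewrite exprS -mulrA ler_wpM2l ?doubling_ge0.
Qed.

(** Normalized convolution of the indicators of B(2r) and B(r). Being an average
    of products of a function of x by a function of y at z = x y^-1, it is a
    multiplier to which [kbound_avg] applies. *)
Definition cutoff r (z : G) : R :=
  \sum_(b <- lball r | (z * b)%g \in lball (2 * r)) (vol r)^-1.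

Lemma cutoff1 r z : 0 <= r -> l z <= r -> cutoff r z = 1.
Proof.
move=> r0 zr; rewrite /cutoff big_seq_cond (eq_bigl (fun b => b \in lball r)); last first.
  move=> b; apply: andb_idr; rewrite !in_lball => br.
  by apply: le_trans (lenM _ _) _; rewrite mulr_natl mulr2n lerD.
rewrite -big_seq big_const_seq count_predT iter_addr_0.
by rewrite -mulr_natl divff// gt_eqF ?vol_gt0.
Qed.

Lemma cutoff0 r z : 3 * r < l z -> cutoff r z = 0.
Proof.
move=> rz; rewrite /cutoff big_seq_cond big1// => b; rewrite !in_lball => /andP[br zb].
have := lenM (z * b)%g b^-1%g; rewrite mulgK lenV; lra.
Qed.

Lemma cutoff_ge0 r z : 0 <= r -> 0 <= cutoff r z.
Proof. by move=> r0; apply: sumr_ge0 => b _; rewrite invr_ge0 ltW ?vol_gt0. Qed.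

Lemma cutoff_le1 r z : 0 <= r -> cutoff r z <= 1.
Proof.
move=> r0; rewrite -(@cutoff1 r 1%g) ?len1// /cutoff.
rewrite big_mkcond [leRHS]big_mkcond big_seq [leRHS]big_seq; apply: ler_sum => b.
rewrite mul1g !in_lball => br; have -> : l b <= 2 * r by lra.
by case: ifP => // _; rewrite invr_ge0 ltW ?vol_gt0.
Qed.

Lemma kbound_cutoff (K : G -> G -> C) M r : 0 <= M -> 1 <= r -> kbound K M ->
  kbound (fun x y => K x y * (cutoff r (x * y^-1)%g)%:C%C) (D * M).
Proof.
move=> M0 r1 bK; have v0 := vol_gt0 (le_trans ler01 r1).
have vi0 : 0 <= (vol r)^-1 by rewrite invr_ge0 ltW.
have bK' (g : G) := kboundZ (vol r)^-1%:C%C bK.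
have v1 : vol r <= D * vol r by rewrite ler_peMl ?doubling_ge1// ltW.
have := kbound_avg (mulr_ge0 (normc_ge0 _) M0) bK' (D_doubling r1) v1.
rewrite normc_real ger0_norm// mulrA mulfK ?gt_eqF//.
apply: kbound_ext => x y; rewrite /cutoff rmorph_sum mulr_sumr.
by apply: eq_bigr => b _; rewrite mulrC.
Qed.

(** The kernel is cut to y in the ball of radius s, where [kbound_separated]
    gives the bound M / s; right translates of this piece satisfy the same
    bound, and [kbound_avg] reassembles the whole kernel from them. *)
Lemma kbound_localized (F : G -> C) (M N s : R) : 0 <= M -> 0 <= N -> 1 <= s ->
  (forall z, F z != 0 -> 3 * s <= l z <= 18 * s) ->
  kbound (lambda_kernel F) N -> kbound (dirac_kernel F) M ->
  kbound (lambda_kernel F) (D ^+ 5 * (M / s)).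
Proof.
move=> M0 N0 s1 hF bN bM; have s0 : 0 < s by exact: lt_le_trans s1.
pose ind (y : G) : C := (l y <= s)%R%:R; pose one (x : G) : C := 1.
have ind1 y : normc (ind y) <= 1.
  by rewrite /ind; case: (l y <= s); rewrite ?normc1 ?normc0.
have one1 y : normc (one y) <= 1 by rewrite normc1.
pose K1 x y := lambda_kernel F x y * one x * ind y.
have bK1 : kbound K1 (M / s).
  apply: (@kbound_separated _ _ l _ (M / s) N s) => //.
  - by rewrite divr_ge0// ltW.
  - exact: len_ge0.
  - move=> x y; rewrite /K1 /ind; case: (boolP (l y <= s)) => ys; last by rewrite mulr0 eqxx.
    rewrite /one !mulr1 => /hF/andP[h _]; split=> //.
    by have := len_quotient x y; lra.
  - exact: kbound_weight N0 one1 ind1 bN.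
  - rewrite mulrC divfK ?gt_eqF//.
    apply: kbound_ext (kbound_weight M0 one1 ind1 bM) => x y.
    by rewrite /K1 /dirac_kernel /lambda_kernel !mulrA.
have v0 := vol_gt0 (ltW s0).
have bK (g : G) := kboundZ (vol s)^-1%:C%C (kbound_transl g bK1).
(* 32 = 2^5 exceeds the radius 18 + 1 that contains x g whenever y g is in the
   ball of radius s. *)
have v32 : vol (2 ^+ 5 * s) <= D ^+ 5 * vol s by exact: vol_doubling_iter.
have v1 : vol s <= D ^+ 5 * vol s by rewrite ler_peMl ?exprn_ege1 ?doubling_ge1// ltW.
have Ms0 : 0 <= M / s by rewrite divr_ge0// ltW.
have := kbound_avg (mulr_ge0 (normc_ge0 _) Ms0) bK v32 v1.
rewrite normc_real ger0_norm ?invr_ge0 ?(ltW v0)//.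
rewrite [X in kbound _ X](_ : _ = D ^+ 5 * (M / s)); last first.
  by field; rewrite !gt_eqF.
apply: kbound_ext => x y; rewrite -/(lambda_kernel F x y).
have [F0|F0] := eqVneq (lambda_kernel F x y) 0.
  rewrite F0 big1// => b _; rewrite /K1 /lambda_kernel invgM mulgA mulgK.
  by rewrite -/(lambda_kernel F x y) F0 !mul0r mulr0.
have /andP[_ zs] := hF _ F0.
rewrite big_seq_cond (eq_bigl (fun b => b \in lball s)); last first.
  move=> b; apply: andb_idr; rewrite !in_lball => bs.
  apply: le_trans (lenM _ _) _; apply: le_trans (lerD zs bs) _.
  rewrite -[X in _ + X]mul1r -mulrDl ler_wpM2r ?(ltW s0)//; lra.
rewrite big_seq_cond (eq_bigr (fun b => (vol s)^-1%:C%C * lambda_kernel F x y)).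
  rewrite -big_seq_cond -big_seq big_const_seq count_predT iter_addr_0.
  rewrite -mulr_natl mulrA -(rmorph_nat (real_complex R)) -rmorphM divff ?gt_eqF//.
  by rewrite mul1r.
move=> b /andP[+ _]; rewrite in_lball => bs; congr (_ * _).
rewrite /K1 /lambda_kernel invgM mulgA mulgK /one /ind mulVKg bs.
by rewrite !mulr1.
Qed.

(** Dyadic summation: the piece of f between the cutoffs of radii 2^k r and
    2^(k+1) r has norm at most 6 D^6 M / (2^k r) by localization. The sum is
    finite because f has finite support, and then the last cutoff is 1 on it. *)
Lemma kbound_tail f (M r : R) : 0 <= M -> 3 <= r -> kbound (dirac_kernel f) M ->
  kbound (fun x y => lambda_kernel f x y * (1 - cutoff r (x * y^-1)%g)%:C%C)
    (12 * D ^+ 6 * M / r).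
Proof.
move=> M0 r3 bM; have r0 : 0 < r by exact: lt_le_trans r3.
set c := 12 * D ^+ 6 * M / r.
have c0 : 0 <= c by rewrite divr_ge0 ?mulr_ge0 ?exprn_ge0 ?doubling_ge0 ?(ltW r0).
pose rr n : R := 2 ^+ n * r.
have rr3 n : 3 <= rr n.
  by apply: le_trans r3 _; exact: le_pow2M (ltW r0).
have rr1 n : 1 <= rr n by apply: le_trans (rr3 n); rewrite ler1n.
have rr0 n : 0 <= rr n by apply: le_trans (rr1 n).
have step n : kbound (fun x y => lambda_kernel f x y *
    (cutoff (rr n.+1) (x * y^-1)%g - cutoff (rr n) (x * y^-1)%g)%:C%C) (c / 2 / 2 ^+ n).
  pose F z : C := f z * (cutoff (rr n.+1) z - cutoff (rr n) z)%:C%C.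
  have diff K B : 0 <= B -> kbound K B -> kbound (fun x y => K x y *
      (cutoff (rr n.+1) (x * y^-1)%g - cutoff (rr n) (x * y^-1)%g)%:C%C) (D * B + D * B).
    move=> B0 bK; apply: kbound_ext (kboundB (kbound_cutoff B0 (rr1 n.+1) bK)
      (kbound_cutoff B0 (rr1 n) bK)) => x y.
    by rewrite rmorphB mulrBr.
  have bN : kbound (lambda_kernel f) (nrm (lambda f)).
    by apply: kbound_ext (kbound_nrm (lambda f)) => x y; rewrite opker_lambda.
  have DM0 : 0 <= D * M + D * M by rewrite addr_ge0 ?mulr_ge0 ?doubling_ge0.
  have DN0 : 0 <= D * nrm (lambda f) + D * nrm (lambda f).
    by rewrite addr_ge0 ?mulr_ge0 ?doubling_ge0 ?nrm_ge0.
  (* F lives where rr n <= l <= 6 rr n, which is 3 s <= l <= 18 s. *)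
  have := @kbound_localized F _ _ (rr n / 3) DM0 DN0.
  have -> : D ^+ 5 * ((D * M + D * M) / (rr n / 3)) = c / 2 / 2 ^+ n.
    rewrite /c /rr; field; rewrite (gt_eqF r0) /= expf_neq0//.
  apply.
  - by rewrite ler_pdivlMr// mul1r.
  - move=> z; rewrite /F mulf_eq0 negb_or => /andP[_ h].
    rewrite (_ : 3 * (rr n / 3) = rr n); last by field.
    rewrite (_ : 18 * (rr n / 3) = 3 * rr n.+1); last by rewrite /rr exprS; field.
    apply/andP; split; rewrite leNgt; apply: contra h => h.
      rewrite !cutoff1 ?subrr// ?(ltW h)//; apply: le_trans (ltW h) _.
      by rewrite /rr exprS -mulrA ler_peMl ?ler1n// mulr_ge0 ?exprn_ge0 ?(ltW r0).
    rewrite !cutoff0 ?subrr//; apply: le_lt_trans h.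
    rewrite ler_wpM2l//.
    by rewrite /rr exprS -mulrA ler_peMl ?ler1n// mulr_ge0 ?exprn_ge0 ?(ltW r0).
  - exact: diff (nrm_ge0 _) bN.
  - apply: kbound_ext (diff _ _ M0 bM) => x y.
    by rewrite /dirac_kernel /F mulrA.
have tele n : kbound (fun x y => lambda_kernel f x y *
    (cutoff (rr n) (x * y^-1)%g - cutoff r (x * y^-1)%g)%:C%C) (c - c / 2 ^+ n).
  elim: n => [|n IH].
    rewrite expr0 divr1 subrr /rr expr0 mul1r.
    by apply: kbound_ext (kbound0 (T := G)) => x y; rewrite subrr mulr0.
  have := kboundD (step n) IH.
  rewrite (_ : _ + (_ - _) = c - c / 2 ^+ n.+1); last first.
    by rewrite exprS; field; rewrite expf_neq0.
  by apply: kbound_ext => x y; rewrite -mulrDr -rmorphD /= addrA subrK.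
have [n hn] : exists n, forall z, f z != 0 -> l z <= rr n.
  have [B hB] : exists B, forall z, z \in enum_fset (finsupp f) -> l z <= B.
    elim: (enum_fset _) => [|z s [B IH]]; first by exists 0.
    exists (Num.max B (l z)) => w; rewrite inE => /predU1P[->|/IH ws].
      by rewrite le_max lexx orbT.
    by rewrite le_max ws.
  have B0 : 0 <= `|B| / r by rewrite divr_ge0// ltW.
  have [n hn] := exists_geometric_le B0 ltr01; exists n => z zf.
  apply: le_trans (hB z _) _; first by rewrite mem_finsupp.
  apply: le_trans (ler_norm B) _.
  by move: hn; rewrite !ler_pdivrMr ?exprn_gt0// mul1r.
apply: kbound_le (kbound_ext _ (tele n)).
  by rewrite gerBl divr_ge0 ?exprn_ge0.
move=> x y; have [z0|z0] := eqVneq (lambda_kernel f x y) 0; first by rewrite z0 !mul0r.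
by rewrite [cutoff (rr n) _]cutoff1// hn.
Qed.

End Dirac.

(** * The weak-* topology on states *)

Section WeakStar.
Context {R : realType} {G : groupType}.
Local Notation C := R[i].
Local Notation A := (Cstar R G).
Local Notation St := (@star R G).
Local Notation W := (weak_star St).
Local Open Scope classical_set_scope.

Lemma ltc_normE (z : C) (e : R) : (`|z| < e%:C%C) = (normc z < e).
Proof. by rewrite normc_def ltcR; case: z. Qed.

Lemma eval_near (mu : W) (a : A) (e : R) : 0 < e ->
  \forall nu \near mu, normc ((mu : state St) a - (nu : state St) a) < e.
Proof.
move=> e0.
have ce0 : (0 : C) < e%:C%C by rewrite ltcR.
have h : (fun nu : W => ((nu : state St) a : C^o)) @ mu --> ((mu : state St) a : C^o).
  apply: (@continuous_comp W {ptws A -> C^o} C^o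
    (fun nu : state St => (nu : {ptws A -> C^o})) (fun g => g a)).
    exact: initial_continuous.
  exact: (@proj_continuous A (fun _ => C^o) a).
have /cvgrPdist_lt /(_ _ ce0) := h; apply: filterS => nu.
by rewrite /= ltc_normE.
Qed.

(** Convergence for the weak-* topology is convergence at each element of the
    algebra. *)
Lemma weak_star_filter_cvg (F : set_system W) (mu : W) : Filter F ->
  (forall (a : A) (e : R), 0 < e ->
     F [set nu : W | normc ((mu : state St) a - (nu : state St) a) < e]) ->
  nbhs mu `<=` F.
Proof.
move=> FF h V; rewrite nbhsE => -[U [[B oB BO] Omu] OV].
apply: filterS OV _; rewrite -BO.
pose f := (fun nu : state St => (nu : {ptws A -> C^o})).
have cv : f @ F --> f mu.
  apply/cvg_sup => a V'.
  rewrite nbhsE => -[U' [[B' oB' BO'] O'mu] O'V'].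
  apply: filterS O'V' _; rewrite -BO'.
  have : nbhs ((mu : state St) a : C^o) B'.
    by apply: open_nbhs_nbhs; split => //; move: O'mu; rewrite -BO'.
  move=> /nbhs_ballP[e /= e0 eB].
  have er : 0 < complex.Re e by move: e0; rewrite ltcE => /andP[].
  have eE : e = (complex.Re e)%:C%C.
    by move: e0; rewrite ltcE; case: (e) => p q /= /andP[/eqP ->].
  suff : F [set nu : W | B' ((nu : state St) a)] by [].
  apply: filterS (h a _ er) => nu /= hnu; apply: eB.
  have : `|(mu : state St) a - (nu : state St) a| < e by rewrite eE ltc_normE.
  by rewrite -ball_normE.
by apply: cv; apply: open_nbhs_nbhs; split => //; move: Omu; rewrite -BO.
Qed.

End WeakStar.

(** * The Dirac seminorm is a Lip-norm *)

Section DiracLipNorm.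
Context {R : realType} {G : groupType}.
Local Notation C := R[i].
Local Notation A := (Cstar R G).
Local Notation St := (@star R G).
Local Notation c_c := (@fin_supp_fun R G).
Local Notation Ac := (range (@lambda_cstar R G)).
Implicit Types (f g : c_c).
Variable (l : G -> R).
Hypothesis l_length : length_function l.
Local Notation L := (dirac_seminorm l : A -> \bar R).

Lemma lambda_cstar_lift (a : A) : lambda_range (a : bop R G) -> Ac a.
Proof. by move=> [f _ fa]; exists f => //; apply: val_inj. Qed.

Lemma Ac_linear (c : C) (a b : A) : Ac a -> Ac b -> Ac (c *: a + b).
Proof.
move=> [f _ <-] [g _ <-]; apply: lambda_cstar_lift.
by apply: lambda_rangeD; [apply: lambda_rangeZ; exists f|exists g].
Qed.

Lemma AcZ (c : C) (a : A) : Ac a -> Ac (c *: a).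
Proof. by move=> [f _ <-]; apply: lambda_cstar_lift; apply: lambda_rangeZ; exists f. Qed.

Lemma Ac_star_subalgebra : star_subalgebra St Ac.
Proof.
split.
- apply: lambda_cstar_lift; exact: lambda_range1.
- exact: Ac_linear.
- move=> _ _ [f _ <-] [g _ <-]; apply: lambda_cstar_lift.
  by apply: lambda_rangeM; [exists f|exists g].
- by move=> _ [f _ <-]; rewrite star_lambda; exists (conj_inv f).
Qed.

Lemma Ac_dense : norm_dense (fun a : A => opnorm a) Ac.
Proof.
move=> b e e0; have [f hf] := proj1 (cstar_red_nrmP _) (CstarP b) e e0.
exists (lambda_cstar f); first by exists f.
by rewrite nrmE lee_fin.
Qed.

(** The kernel of the commutator determines s, and this form of the relation is
    visibly linear in the pair (a, s) and compatible with adjoints. *)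
Definition is_dirac (a : A) (s : bop R G) : Prop :=
  forall x y, opker s x y = (l x - l y)%:C%C * opker (a : bop R G) x y.

Lemma is_dirac_exists a : Ac a -> exists s, is_dirac a s.
Proof.
move=> [f _ <-]; have [s hs] := dirac_operator l_length f.
by exists s => x y; rewrite hs opker_lambda.
Qed.

Lemma is_diracE a s : Ac a -> is_dirac a s -> L a = (nrm s)%:E.
Proof.
move=> [f _ <-] hs; rewrite -nrmE; apply: dirac_seminormE => x y.
by rewrite hs opker_lambda.
Qed.

Lemma dirac_star_seminorm : star_seminorm St Ac L.
Proof.
split.
- move=> a Aa; have [s hs] := is_dirac_exists Aa.
  by rewrite (is_diracE Aa hs) lee_fin nrm_ge0 ltry.
- move=> a b Aa Ab; have [s hs] := is_dirac_exists Aa; have [t ht] := is_dirac_exists Ab.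
  have Aab : Ac (a + b) by rewrite -[a]scale1r; apply: Ac_linear.
  rewrite (is_diracE Aa hs) (is_diracE Ab ht) (@is_diracE _ (s + t) Aab).
    by rewrite -EFinD lee_fin nrmD.
  by move=> x y; rewrite opkerD hs ht -mulrDr.
- move=> c a Aa; have [s hs] := is_dirac_exists Aa.
  have Aca := AcZ c Aa.
  rewrite (is_diracE Aa hs) (@is_diracE _ (c *: s) Aca) -?EFinM ?nrmZ//.
  by move=> x y; rewrite opkerZ hs mulrCA.
- move=> a Aa; have [s hs] := is_dirac_exists Aa; have [t st] := exists_adjoint s.
  have Asa : Ac (star a) by case: Ac_star_subalgebra => _ _ _; apply.
  rewrite (is_diracE Aa hs) (@is_diracE _ (- t) Asa) ?nrmN ?(nrm_adjoint st)// => x y.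
  have -> : opker (- t) x y = - opker t x y by [].
  rewrite (proj1 (is_adjoint_kernel _ _) st) (proj1 (is_adjoint_kernel _ _) (star_adjoint a)).
  by rewrite hs rmorphM [X in - (X * _)](conjc_real (l y - l x)) -mulNr -rmorphN opprB.
Qed.

Lemma dirac_one : L 1 = 0%E.
Proof.
have A1 : Ac 1 by case: Ac_star_subalgebra.
have h : is_dirac 1 0.
  move=> x y; have -> : opker ((1 : A) : bop R G) x y = (x == y)%:R by [].
  have -> : opker (0 : bop R G) x y = 0 by [].
  by case: eqVneq => [->|]; rewrite ?subrr ?mul0r ?mulr0.
by rewrite (is_diracE A1 h) nrm0.
Qed.

(** Scaling a by 1 / (L a + 1) brings it into the unit ball of L, also when
    L a = 0. *)
Lemma state_diff_rho a : Ac a ->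
  exists2 k : R, 0 < k & forall (mu nu : state St) (e : R), (rho Ac L mu nu < e%:E)%E ->
    normc (mu a - nu a) <= k * e.
Proof.
move=> Aa; have [s hs] := is_dirac_exists Aa.
have n0 := nrm_ge0 s; have k0 : 0 < nrm s + 1 by lra.
exists (nrm s + 1) => // mu nu e; rewrite /rho => he.
pose c : C := (nrm s + 1)^-1%:C%C.
have nc : normc c = (nrm s + 1)^-1 by rewrite normc_real ger0_norm// invr_ge0 ltW.
have Aca := AcZ c Aa.
have := le_lt_trans (ereal_sup_ubound _) he.
move=> /(_ (normc (mu (c *: a) - nu (c *: a)))%:E) H.
have : ((normc (mu (c *: a) - nu (c *: a)))%:E < e%:E)%E.
  apply: H; exists (c *: a) => //=; split=> //.
  rewrite (@is_diracE _ (c *: s) Aca); last by move=> x y; rewrite opkerZ hs mulrCA.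
  by rewrite nrmZ nc lee_fin ler_pdivrMl// mulr1 lerDl.
rewrite lte_fin !stateZ -mulrBr normcM nc ltr_pdivrMl// => /ltW.
by [].
Qed.

Lemma state_diff_cstar (mu nu : state St) (a b : A) :
  normc (mu a - nu a) <= normc (mu b - nu b) + 16 * nrm (a - b).
Proof.
have -> : mu a - nu a = (mu b - nu b) + (mu (a - b) - nu (a - b)).
  by rewrite !stateB; ring.
apply: le_trans (le_normcD _ _) _; rewrite lerD2l.
apply: le_trans (normcB _ _) _.
have := state_bounded mu (a - b); have := state_bounded nu (a - b).
rewrite -![nrm (\val (a - b))]/(nrm (a - b)); lra.
Qed.

(** An element of the completed algebra is approximated by one of c_c, uniformly
    on states, and on the latter the difference of states is controlled by
    rho. *)
Lemma weak_star_open_rho_open (U : set (state St)) :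
  @open (weak_star St) U -> rho_open Ac L U.
Proof.
move=> oU mu Umu.
(* The filter of rho-neighbourhoods of mu. *)
pose F : set_system (weak_star St) := fun V => exists2 e : R, 0 < e &
  forall nu : state St, (rho Ac L mu nu < e%:E)%E -> V nu.
have FF : Filter F.
  split.
  - by exists 1.
  - move=> V V' [e e0 h] [e' e'0 h']; exists (Num.min e e'); first by rewrite lt_min e0.
    move=> nu; rewrite EFin_min lt_min => /andP[h1 h2].
    by split; [exact: h|exact: h'].
  - by move=> V V' VV' [e e0 h]; exists e => // nu /h /VV'.
apply: (@weak_star_filter_cvg _ _ F mu FF _ U); last exact: open_nbhs_nbhs.
move=> a e e0; have e64 : 0 < e / 64 by rewrite divr_gt0.
have [f hf] := proj1 (cstar_red_nrmP _) (CstarP a) _ e64.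
have Af : Ac (lambda_cstar f) by exists f.
have [k k0 hk] := state_diff_rho Af.
have ek : 0 < e / 2 / k by rewrite !divr_gt0.
exists (e / 2 / k) => // nu /hk; rewrite mulrC divfK ?gt_eqF// => h /=.
apply: le_lt_trans (state_diff_cstar _ _ _ (lambda_cstar f)) _.
have hf' : nrm (a - lambda_cstar f) <= e / 64 by [].
lra.
Qed.

Hypothesis l_doubling : bounded_doubling l.

Definition point (z : G) : c_c := [fsfun x in [fset z]%fset => 1].

Lemma lambda_point z : lambda (point z) = transl R z.
Proof.
rewrite (@lambdaE _ _ _ [fset z]%fset) => [|a az].
  by rewrite big_seq_fset1 fsfunE inE eqxx scale1r.
by rewrite fsfunE (negbTE az).
Qed.

Lemma lambda_cstar_sum f (S : {fset G}) : (forall z, z \notin S -> f z = 0) ->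
  lambda_cstar f = \sum_(z <- S) f z *: lambda_cstar (point z).
Proof.
move=> fS; apply: val_inj; rewrite raddf_sum /= (lambdaE fS).
by apply: eq_bigr => z _; rewrite -lambda_point.
Qed.

Lemma lambda_cstar_point1 : lambda_cstar (point 1%g) = 1.
Proof.
apply: val_inj; rewrite /= lambda_point; apply: opker_inj => x y.
by rewrite /opker /= invg1 mul1g.
Qed.

(** The tail beyond B(3r) is estimated in norm. On B(3r) the entry of the
    commutator at (z, 1) bounds the coefficient of a at z by 1 / l z; at z = 1
    the two states agree, in accordance with the value 0 of the inverse
    of 0. *)
Lemma state_diff_truncate (mu nu : state St) (D r : R) :
  (forall r, 1 <= r -> #|` fset_set (length_ball l (2 * r))|%:R <=
      D * #|` fset_set (length_ball l r)|%:R) -> 3 <= r ->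
  forall a, Ac a -> (L a <= 1)%E ->
  normc (mu a - nu a) <= 192 * D ^+ 6 / r +
    \sum_(z <- lball l (3 * r)) (l z)^-1 *
      normc (mu (lambda_cstar (point z)) - nu (lambda_cstar (point z))).
Proof.
have [l_proper _] := l_doubling; move=> hD r3 _ [f _ <-].
have r0 : 0 < r by exact: lt_le_trans r3.
rewrite (dirac_seminorm_leP l_length f ler01) => bf.
pose phi := cutoff l r.
pose g : c_c := [fsfun z in finsupp f => f z * (phi z)%:C%C].
have gE z : g z = f z * (phi z)%:C%C.
  by rewrite fsfunE; case: finsuppP => // _; rewrite mul0r.
apply: le_trans (state_diff_cstar mu nu _ (lambda_cstar g)) _.
rewrite addrC lerD//.
  rewrite (_ : 192 * _ / r = 16 * (12 * D ^+ 6 * 1 / r)); last by ring.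
  rewrite ler_wpM2l//; apply/nrm_kbound.
    by rewrite divr_ge0 ?(ltW r0)// !mulr_ge0 ?exprn_ge0// (doubling_ge0 l_length l_proper hD).
  apply: kbound_ext (kbound_tail l_length l_proper hD ler01 r3 bf) => x y.
  by rewrite opkerB !opker_lambda gE /lambda_kernel rmorphB /= mulrBr mulr1.
rewrite (@lambda_cstar_sum g (lball l (3 * r))) => [|z]; last first.
  by rewrite in_lball// -ltNge gE /phi => h; rewrite cutoff0// mulr0.
rewrite !state_sum -sumrB; apply: le_trans (le_normc_sum _ _ _) _.
apply: ler_sum => z _; rewrite !stateZ -mulrBr normcM.
have [->|z1] := eqVneq z 1%g.
  by rewrite lambda_cstar_point1 !state_unital subrr normc0 !mulr0.
rewrite ler_wpM2r ?normc_ge0//.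
have lz : 0 < l z.
  rewrite lt_neqAle (len_ge0 l_length) andbT eq_sym.
  by apply: contra z1 => /eqP/(len_eq0 l_length) ->.
have := kbound_entry z 1%g bf.
rewrite /dirac_kernel invg1 mulg1 (len1 l_length) subr0 normcM normc_real gtr0_norm//.
rewrite -ler_pdivlMl// mulr1; apply: le_trans.
(* The coefficient of g at z is at most that of f, as the cutoff is in [0, 1]. *)
rewrite gE normcM ler_piMr ?normc_ge0// normc_real ger0_norm.
  exact: cutoff_le1 (ltW r0).
exact: cutoff_ge0 (ltW r0).
Qed.

(** The radius r is chosen first, to make the tail small; then closeness of the
    two states on the finite ball of radius 3r makes rho small. *)
Lemma rho_open_weak_star_open (U : set (state St)) :
  rho_open Ac L U -> @open (weak_star St) U.
Proof.
move=> rU; rewrite openE => mu Umu; have [e e0 he] := rU mu Umu.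
have [l_proper [D hD]] := l_doubling.
have D0 := doubling_ge0 l_length l_proper hD.
have [r r3 hr] : exists2 r, 3 <= r & 192 * D ^+ 6 / r <= e / 4.
  have p0 : 0 <= 192 * D ^+ 6 / (e / 4).
    exact: divr_ge0 (mulr_ge0 (ler0n _ 192) (exprn_ge0 6 D0)) (ltW (divr_gt0 e0 (ltr0Sn _ 3))).
  have r0 : 0 < 3 + 192 * D ^+ 6 / (e / 4) by lra.
  exists (3 + 192 * D ^+ 6 / (e / 4)); first by rewrite lerDl.
  rewrite ler_pdivrMr// mulrDr [_ / 4 * (_ / _)]mulrC divfK; last by rewrite gt_eqF// divr_gt0.
  by rewrite lerDr mulr_ge0// divr_ge0 ?ltW.
pose K := \sum_(z <- lball l (3 * r)) (l z)^-1.
have K0 : 0 <= K by apply: sumr_ge0 => z _; rewrite invr_ge0 (len_ge0 l_length).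
have K1 : 0 < K + 1 by lra.
pose d := e / 4 / (K + 1); have d0 : 0 < d by rewrite /d !divr_gt0.
have near_all s : nbhs (mu : weak_star St) [set nu : weak_star St |
    forall z, z \in (s : seq G) -> normc (mu (lambda_cstar (point z)) -
      (nu : state St) (lambda_cstar (point z))) < d]%classic.
  have FF : Filter (nbhs (mu : weak_star St)) by exact: nbhs_filter.
  elim: s => [|z s IH]; first by apply: filterE.
  have h := eval_near (mu : weak_star St) (lambda_cstar (point z)) d0.
  by apply: filterS2 h IH => nu h1 h2 w; rewrite inE => /predU1P[->|/h2].
apply: filterS (near_all (enum_fset (lball l (3 * r)))) => nu hnu; apply: he.
apply: (@le_lt_trans _ _ (e / 2)%:E); last by rewrite lte_fin; lra.
apply: ge_ereal_sup => _ [a [Aa La] <-]; rewrite lee_fin.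
apply: le_trans (state_diff_truncate mu nu hD r3 Aa La) _.
suff : \sum_(z <- lball l (3 * r)) (l z)^-1 *
      normc (mu (lambda_cstar (point z)) - nu (lambda_cstar (point z))) <= e / 4 by lra.
apply: (@le_trans _ _ (K * d)).
  rewrite mulr_suml big_seq [leRHS]big_seq; apply: ler_sum => z zB.
  by rewrite ler_wpM2l ?invr_ge0 ?(len_ge0 l_length)// ltW// hnu.
rewrite /d mulrA ler_pdivrMr// mulrC ler_wpM2l ?divr_ge0 ?(ltW e0)//; lra.
Qed.

End DiracLipNorm.

Theorem theorem1p4 (R : realType) (G : groupType) (l : G -> R)
    (l_length : length_function l) (l_doubling : bounded_doubling l) :
  lip_norm (@star R G) (fun a : Cstar R G => opnorm a)
    (range (@lambda_cstar R G)) (dirac_seminorm l).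
Proof.
split.
- exact: Ac_star_subalgebra.
- exact: Ac_dense.
- exact: dirac_star_seminorm.
- exact: dirac_one.
- move=> U; split; first exact: rho_open_weak_star_open.
  exact: weak_star_open_rho_open.
Qed.
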